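(* Let $(R,\mathfrak m)$ be a Cohen-Macaulay local ring of dimension two with infinite residue field, let $I,J$ be $\mathfrak m$-primary ideals of $R$, and let $(a,b)$ be a Rees-joint reduction of $I$ and $J$. Then: (a) for all $r,s\gg0$, $e_{(0,1)}-e_1(J)=\sum_{i=0}^{r-1}\ell(M^1_{i,s})$ and $e_{(1,0)}-e_1(I)=\sum_{i=0}^{s-1}\ell(M^1_{r,i})$; (b) $e_{(0,1)}\ge e_1(J)$ (resp. $e_{(1,0)}\ge e_1(I)$), and equality holds if and only if $M^1_{i,s}=0$ for all $i\ge0$ and $s\gg0$ (resp. $M^1_{r,i}=0$ for all $i\ge0$ and $r\gg0$); (c) for each $i\ge0$ and all $s\gg0$ (resp. $r\gg0$), $\ell(M^1_{i,s})$ (resp. $\ell(M^1_{r,i})$) is independent of $s$ (resp. $r$).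
   Context: $\ell$ denotes length of $R$-modules, and $I^0=J^0=R$. A pair $(a,b)$ is a joint reduction of $I$ and $J$ if $a\in I$, $b\in J$ and $I^{r+1}J^{s+1}=aI^rJ^{s+1}+bI^{r+1}J^s$ for all large $r,s$. It is a Rees-joint reduction if moreover $(a)\cap I^rJ^s=aI^{r-1}J^s$ for $r\gg0$ and all $s\ge0$, and $(b)\cap I^rJ^s=bI^rJ^{s-1}$ for $s\gg0$ and all $r\ge0$. For $r,s\ge0$: $M^1_{r,s}:=\dfrac{I^{r+1}J^{s+1}}{aI^rJ^{s+1}+bI^{r+1}J^s}$. Hilbert coefficients: for an $\mathfrak m$-primary ideal $K$, $\ell(R/K^n)=e_0(K)\binom{n+1}{2}-e_1(K)n+e_2(K)$ for $n\gg0$. Bigraded Hilbert coefficients $e_{(i,j)}$ of $\{I^rJ^s\}$: $\ell(R/I^rJ^s)=\sum_{i+j\le 2}(-1)^{i+j}e_{(i,j)}\binom{r+i-1}{i}\binom{s+j-1}{j}$ for all $r,s\gg0$. *)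

(* Defs.v *)
From HB Require Import structures.
From mathcomp Require Import all_boot all_order all_algebra.
From mathcomp Require Import boolp classical_sets functions cardinality.
From mathcomp Require Import constructive_ereal.

Set Implicit Arguments.
Unset Strict Implicit.
Unset Printing Implicit Defensive.

Import Order.TTheory GRing.Theory Num.Theory.
Local Open Scope classical_set_scope.
Local Open Scope ring_scope.

Section CommutativeAlgebra.
Variable R : comNzRingType.
Implicit Types (A B C I J K P m : set R) (a b : R).

(* Not the library's [idealr_closed], which forces ideals to be proper. *)
Definition ideal A : Prop :=
  [/\ A 0,
      forall x y, A x -> A y -> A (x + y)
    & forall c x, A x -> A (c * x)].

Definition ideal_span (S : set R) : set R := smallest ideal S.

Definition ideal_add A B : set R := [set x + y | x in A & y in B].

Definition ideal_mul A B : set R := ideal_span [set x * y | x in A & y in B].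

Fixpoint ideal_exp A (n : nat) : set R :=
  if n is n'.+1 then ideal_mul A (ideal_exp A n') else setT.

Definition principal a : set R := [set c * a | c in setT].

Definition ideal_scale a A : set R := [set a * x | x in A].

Definition proper_ideal A : Prop := ideal A /\ ~ A 1.

Definition prime_ideal P : Prop :=
  proper_ideal P /\ forall x y, P (x * y) -> P x \/ P y.

Definition maximal_ideal m : Prop :=
  proper_ideal m /\ forall A, proper_ideal A -> m `<=` A -> A = m.

Definition primary_ideal A : Prop :=
  proper_ideal A /\
  forall x y, A (x * y) -> A x \/ exists n : nat, A (y ^+ n).

Definition radical A : set R := [set x | exists n : nat, A (x ^+ n)].

Definition is_primary_to m K : Prop := primary_ideal K /\ radical K = m.

Definition noetherian : Prop :=
  forall A, ideal A -> exists s : seq R, A = ideal_span [set` s].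

Definition noetherian_local m : Prop :=
  [/\ noetherian, maximal_ideal m & forall m', maximal_ideal m' -> m' = m].

(* The elements of the residue field R/m are the cosets x + m. *)
Definition infinite_residue_field m : Prop :=
  infinite_set (range (fun x : R => [set y | m (y - x)])).

(* A chain of length n has n strict inclusions, hence n + 1 terms. *)
Definition strict_chain (F : set (set R)) (n : nat) : Prop :=
  exists N : nat -> set R,
    (forall i, (i <= n)%N -> F (N i)) /\
    (forall i, (i < n)%N -> N i `<` N i.+1).

Definition max_chain_length (F : set (set R)) (n : nat) : Prop :=
  strict_chain F n /\ forall k, strict_chain F k -> (k <= n)%N.

Definition krull_dim (d : nat) : Prop := max_chain_length prime_ideal d.

Definition regular_sequence (s : seq R) : Prop :=
  (forall i, (i < size s)%N -> forall y,
     ideal_span [set` take i s] (s`_i * y) -> ideal_span [set` take i s] y)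
  /\ ~ ideal_span [set` s] 1.

Definition regular_sequence_in m (s : seq R) : Prop :=
  regular_sequence s /\ [set` s] `<=` m.

Definition depth m (d : nat) : Prop :=
  (exists2 s, regular_sequence_in m s & size s = d) /\
  forall s, regular_sequence_in m s -> (size s <= d)%N.

Definition cohen_macaulay_local m : Prop :=
  noetherian_local m /\ exists2 d, krull_dim d & depth m d.

(* [Subquot A B] stands for the R-module A / B, for ideals B `<=` A. *)
Record subquot := Subquot { sq_num : set R; sq_den : set R }.

Definition sq_zero (M : subquot) : Prop := sq_num M `<=` sq_den M.

(* The ideals C with B `<=` C `<=` A are the submodules C / B of A / B. *)
Definition submodules (M : subquot) : set (set R) :=
  [set C | [/\ ideal C, sq_den M `<=` C & C `<=` sq_num M]].

(* +oo when the lengths of chains of submodules are unbounded. *)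
Definition mod_length (M : subquot) : \bar int :=
  xget +oo%E [set (n%:Z)%:E%E | n in max_chain_length (submodules M)].

Definition bipower I J (r s : nat) : set R :=
  ideal_mul (ideal_exp I r) (ideal_exp J s).

Definition joint_den I J a b (r s : nat) : set R :=
  ideal_add (ideal_scale a (bipower I J r s.+1))
            (ideal_scale b (bipower I J r.+1 s)).

Definition joint_reduction I J a b : Prop :=
  [/\ I a, J b
    & exists N : nat, forall r s, (N <= r)%N -> (N <= s)%N ->
        bipower I J r.+1 s.+1 = joint_den I J a b r s].

Definition rees_joint_reduction I J a b : Prop :=
  [/\ joint_reduction I J a b,
      exists N : nat, forall r s, (N <= r)%N ->
        principal a `&` bipower I J r.+1 s = ideal_scale a (bipower I J r s)
    & exists N : nat, forall r s, (N <= s)%N ->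
        principal b `&` bipower I J r s.+1 = ideal_scale b (bipower I J r s)].

Definition M1 I J a b (r s : nat) : subquot :=
  Subquot (bipower I J r.+1 s.+1) (joint_den I J a b r s).

Definition is_hilbert_coefs K (e : int * int * int) : Prop :=
  let: (e0, e1, e2) := e in
  exists N : nat, forall n, (N <= n)%N ->
    mod_length (Subquot setT (ideal_exp K n)) =
    (e0 * ('C(n.+1, 2))%:Z - e1 * n%:Z + e2)%:E%E.

(* Coefficients in dimension two; 0 if there is no Hilbert polynomial of
   this shape, which does not happen for m-primary ideals. *)
Definition hilbert_coefs K : int * int * int :=
  xget (0, 0, 0) (is_hilbert_coefs K).

Definition hilbert_e1 K : int := (hilbert_coefs K).1.2.

(* The entries with i + j > 2 are irrelevant. *)
Definition is_bihilbert_coefs I J (e : 'M[int]_3) : Prop :=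
  exists N : nat, forall r s, (N <= r)%N -> (N <= s)%N ->
    mod_length (Subquot setT (bipower I J r s)) =
    (\sum_(i < 3) \sum_(j < 3 | (i + j <= 2)%N)
       (-1) ^+ (i + j) * e i j *
       ('C(r + i - 1, i))%:Z * ('C(s + j - 1, j))%:Z)%:E%E.

Definition bihilbert_coefs I J : 'M[int]_3 := xget 0 (is_bihilbert_coefs I J).

Definition bihilbert_e I J (i j : 'I_3) : int := bihilbert_coefs I J i j.

End CommutativeAlgebra.

(* Main.v *)
(* Write f(r,s) for the colength of I^r J^s, g_r(s) = f(r,s+1) - f(r,s), and e
   for the colength of (a,b).  Since (a,b) is a regular sequence and, by the Rees
   condition, (I^r J^(s+1) : b) = I^r J^s for s >> 0 and all r, the formula
   l(A) = l(A : x) + l(A + (x)) for colengths gives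
     g_r(s) = l(R/(I^r J^(s+1) + (b)))  and
     l(M^1_(r,s)) = e - (g_(r+1)(s) - g_r(s))          (s >> 0, all r).
   The first identity makes g_r increase with r, so l(M^1_(r,s)) <= e.  By
   Hilbert-Serre, s |-> l(M^1_(r,s)) is eventually polynomial; being bounded it is
   eventually constant, which is (c).  Likewise g_0 has bounded increments, so it
   is eventually linear: g_0(s) = alpha (s+1) - e_1(J).  As M^1_(r,s) = 0 for
   r, s >> 0, there g_r(s) = alpha (s+1) + e r - e_(0,1), and telescoping the
   second identity from r = 0 yields (a), hence (b). *)
Require Import Defs.
From HB Require Import structures.
From mathcomp Require Import all_boot all_order all_algebra.
From mathcomp Require Import boolp classical_sets functions cardinality.
From mathcomp Require Import constructive_ereal.
From mathcomp Require Import zify ring.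

Set Implicit Arguments.
Unset Strict Implicit.
Unset Printing Implicit Defensive.

Import Order.TTheory GRing.Theory Num.Theory.
Local Open Scope classical_set_scope.
Local Open Scope ring_scope.

(** * Ideals *)

Section IdealArithmetic.
Variable R : comNzRingType.
Implicit Types (A B C D : set R) (x y z : R).

(** Depth two only provides some regular sequence x, z in m. The ideal (a,b) contains I^(r+1)
    J^(s+1) for large r, s, hence a power of m, hence x^k and z^k, and these force the Koszul
    complex of (a,b) to be exact in degree one. That exactness, rather than regularity of a, b in a
    given order, is what is carried along, because it is symmetric in a and b. The obstacle is
    uniformity: the bound on s that Hilbert-Serre yields depends on r, whereas (a) and (b) ask for
    one bound for all r. The Rees condition on b has a bound on s that is independent of r, and the
    joint reduction equality gives g_(r+1) - g_r = e for all large r and s at once. For (a) and (b),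
    Hilbert-Serre is therefore applied to finitely many rows only; (c) allows a bound for each row.
    The coefficients e_1 and e_(i,j) are read off a chosen polynomial. They are identified by
    summing first differences, which shows that such a polynomial exists, and by comparing
    differences, which shows that its coefficients are forced. *)

Lemma ideal0 A : ideal A -> A 0. Proof. by case. Qed.

Lemma idealD A x y : ideal A -> A x -> A y -> A (x + y).
Proof. by case=> _ h _; apply: h. Qed.

Lemma idealMl A x y : ideal A -> A y -> A (x * y).
Proof. by case=> _ _; apply. Qed.

Lemma idealMr A x y : ideal A -> A x -> A (x * y).
Proof. by move=> iA Ax; rewrite mulrC; apply: idealMl. Qed.

Lemma idealN A x : ideal A -> A x -> A (- x).
Proof. by move=> iA Ax; rewrite -mulN1r; apply: idealMl. Qed.

Lemma idealB A x y : ideal A -> A x -> A y -> A (x - y).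
Proof. by move=> iA Ax Ay; apply: idealD => //; apply: idealN. Qed.

Lemma ideal_sum A (T : Type) (r : seq T) (P : pred T) (F : T -> R) :
  ideal A -> (forall i, P i -> A (F i)) -> A (\sum_(i <- r | P i) F i).
Proof.
move=> iA AF; apply: big_ind => //; first exact: ideal0.
by move=> x y; apply: idealD.
Qed.

Lemma idealT : ideal (setT : set R).
Proof. by []. Qed.

Lemma ideal1 : ideal (set1 0 : set R).
Proof. by split=> //= [x y -> ->|c x ->]; rewrite ?addr0 ?mulr0. Qed.

Lemma idealI A B : ideal A -> ideal B -> ideal (A `&` B).
Proof.
move=> iA iB; split=> [|x y [? ?] [? ?]|c x [? ?]]; split;
  by [apply: ideal0 | apply: idealD | apply: idealMl].
Qed.

Lemma span_ideal (S : set R) : ideal (ideal_span S).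
Proof.
split=> [A [] /ideal0 //|x y hx hy A [iA SA]|c x hx A [iA SA]].
  by apply: idealD => //; [apply: hx | apply: hy].
by apply: idealMl => //; apply: hx.
Qed.

Lemma span_sub (S : set R) : S `<=` ideal_span S.
Proof. exact: sub_gen_smallest. Qed.

Lemma span_min (S : set R) A : ideal A -> S `<=` A -> ideal_span S `<=` A.
Proof. exact: smallest_sub. Qed.

Lemma span_mono (S S' : set R) : S `<=` S' -> ideal_span S `<=` ideal_span S'.
Proof.
by move=> h; apply: span_min (span_ideal _) _; apply: subset_trans h (@span_sub _).
Qed.

Lemma add_ideal A B : ideal A -> ideal B -> ideal (ideal_add A B).
Proof.
move=> iA iB; split.
- by exists 0; [apply: ideal0 | exists 0; [apply: ideal0 | rewrite addr0]].
- move=> _ _ [a Aa [b Bb <-]] [a' Aa' [b' Bb' <-]].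
  exists (a + a'); first exact: idealD.
  by exists (b + b'); [apply: idealD | rewrite addrACA].
- move=> c _ [a Aa [b Bb <-]].
  exists (c * a); first exact: idealMl.
  by exists (c * b); [apply: idealMl | rewrite mulrDr].
Qed.

Lemma add_memP A B x y : A x -> B y -> ideal_add A B (x + y).
Proof. by move=> Ax By; exists x => //; exists y. Qed.

Lemma addl_sub A B : ideal B -> A `<=` ideal_add A B.
Proof. by move=> iB x Ax; rewrite -[x]addr0; apply: add_memP => //; apply: ideal0. Qed.

Lemma addr_sub A B : ideal A -> B `<=` ideal_add A B.
Proof. by move=> iA x Ax; rewrite -[x]add0r; apply: add_memP => //; apply: ideal0. Qed.

Lemma add_min A B C : ideal C -> A `<=` C -> B `<=` C -> ideal_add A B `<=` C.
Proof. by move=> iC AC BC _ [x /AC ? [y /BC ? <-]]; apply: idealD. Qed.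

Lemma add_comm A B : ideal_add A B = ideal_add B A.
Proof.
by rewrite eqEsubset; split=> _ [x Ax [y By <-]]; rewrite addrC; apply: add_memP.
Qed.

Lemma add_mono A B C D :
  A `<=` C -> B `<=` D -> ideal_add A B `<=` ideal_add C D.
Proof. by move=> AC BD _ [x /AC ? [y /BD ? <-]]; apply: add_memP. Qed.

Lemma scale_ideal x A : ideal A -> ideal (ideal_scale x A).
Proof.
move=> iA; split.
- by exists 0; [apply: ideal0 | rewrite mulr0].
- move=> _ _ [u Au <-] [v Av <-].
  by exists (u + v); [apply: idealD | rewrite mulrDr].
- by move=> c _ [u Au <-]; exists (c * u); [apply: idealMl | ring].
Qed.

Lemma scale_mono x A B : A `<=` B -> ideal_scale x A `<=` ideal_scale x B.
Proof. by move=> AB _ [u /AB ? <-]; exists u. Qed.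

Lemma scale_sub x A C : ideal C -> C x -> ideal_scale x A `<=` C.
Proof. by move=> iC Cx _ [u _ <-]; apply: idealMr. Qed.

(** Besides its role in colengths, this ideal extends a membership of products from generators to
    the ideal that they span. *)
Definition colon A x : set R := [set y | A (x * y)].

Lemma colon_ideal A x : ideal A -> ideal (colon A x).
Proof.
move=> iA; split=> [|y z Ay Az|c y Ay]; rewrite /colon /=.
- by rewrite mulr0; apply: ideal0.
- by rewrite mulrDr; apply: idealD.
- by rewrite mulrCA; apply: idealMl.
Qed.

Lemma mul_ideal A B : ideal (ideal_mul A B).
Proof. exact: span_ideal. Qed.
Arguments mul_ideal : clear implicits.

Lemma mul_memP A B x y : A x -> B y -> ideal_mul A B (x * y).
Proof. by move=> Ax By; apply: span_sub; exists x => //; exists y. Qed.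

Lemma mul_min A B C : ideal C -> (forall x y, A x -> B y -> C (x * y)) ->
  ideal_mul A B `<=` C.
Proof. by move=> iC h; apply: span_min => // _ [x Ax [y By <-]]; apply: h. Qed.

Lemma mul_comm A B : ideal_mul A B = ideal_mul B A.
Proof.
rewrite eqEsubset; split; apply: mul_min (mul_ideal _ _) _ => x y Ax By;
  by rewrite mulrC; apply: mul_memP.
Qed.

Lemma mul_mono A B C D :
  A `<=` C -> B `<=` D -> ideal_mul A B `<=` ideal_mul C D.
Proof.
move=> AC BD; apply: mul_min; first exact: mul_ideal.
by move=> x y /AC ? /BD ?; apply: mul_memP.
Qed.

Lemma mul_subr A B : ideal B -> ideal_mul A B `<=` B.
Proof. by move=> iB; apply: mul_min => // x y _; apply: idealMl. Qed.

Lemma mul_subl A B : ideal A -> ideal_mul A B `<=` A.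
Proof. by rewrite mul_comm; apply: mul_subr. Qed.

Lemma mul_assoc_sub A B C :
  ideal_mul A (ideal_mul B C) `<=` ideal_mul (ideal_mul A B) C.
Proof.
apply: mul_min; first exact: mul_ideal.
move=> x + Ax.
suff h : ideal_mul B C `<=` colon (ideal_mul (ideal_mul A B) C) x by exact: h.
apply: mul_min; first exact/colon_ideal/mul_ideal.
by move=> y z By Cz; rewrite /colon /= mulrA; do 2?apply: mul_memP.
Qed.

Lemma mul_assoc A B C :
  ideal_mul A (ideal_mul B C) = ideal_mul (ideal_mul A B) C.
Proof.
rewrite eqEsubset; split; first exact: mul_assoc_sub.
by rewrite mul_comm (mul_comm A B) (mul_comm B C) (mul_comm A); apply: mul_assoc_sub.
Qed.

Lemma mul_setT A : ideal A -> ideal_mul setT A = A.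
Proof.
move=> iA; rewrite eqEsubset; split; first exact: mul_subr.
by move=> x Ax; rewrite -[x]mul1r; apply: mul_memP.
Qed.

Lemma exp_ideal A n : ideal (ideal_exp A n).
Proof. by case: n => [|n]; [exact: idealT | exact: mul_ideal]. Qed.

Arguments exp_ideal : clear implicits.

Lemma exp_memX A x n : A x -> ideal_exp A n (x ^+ n).
Proof. by move=> Ax; elim: n => //= n IH; rewrite exprS; apply: mul_memP. Qed.

Lemma expD A m n :
  ideal_exp A (m + n) = ideal_mul (ideal_exp A m) (ideal_exp A n).
Proof.
elim: m => [|m IH]; first by rewrite mul_setT //; apply: exp_ideal.
by rewrite addSn /= IH mul_assoc.
Qed.

Lemma exp_subn A m n : (m <= n)%N -> ideal_exp A n `<=` ideal_exp A m.
Proof.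
by move=> /subnKC <-; rewrite expD; apply: mul_subl; apply: exp_ideal.
Qed.

(** Induction on p + q: splitting off one factor u + v lowers p on the u part and q on the v
    part. *)
Lemma exp_add_sub A B p q :
  ideal A -> ideal B ->
  ideal_exp (ideal_add A B) (p + q) `<=` ideal_add (ideal_exp A p) (ideal_exp B q).
Proof.
move=> iA iB; move En: (p + q)%N => n.
elim: n p q En => [|n IH] p q En.
  have -> : p = 0%N by lia.
  by move=> x _; apply: addl_sub => //; apply: exp_ideal.
case: p En => [|p] En; first by move=> x _; apply: addl_sub => //; apply: exp_ideal.
case: q En => [|q] En; first by move=> x _; apply: addr_sub => //; apply: exp_ideal.
have iS : ideal (ideal_add (ideal_exp A p.+1) (ideal_exp B q.+1)).
  by apply: add_ideal; apply: exp_ideal.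
rewrite [ideal_exp _ n.+1]/=; apply: mul_min => // _ y [u Au [v Bv <-]] hy.
rewrite mulrDl; apply: (idealD iS).
  have [|s As [t Bt <-]] := IH p q.+1 _ y hy; first by lia.
  rewrite mulrDr; apply: add_memP; first exact: mul_memP.
  exact: (idealMl _ (exp_ideal _ _)).
have [|s As [t Bt <-]] := IH p.+1 q _ y hy; first by lia.
rewrite mulrDr; apply: add_memP; last exact: mul_memP.
exact: (idealMl _ (exp_ideal _ _)).
Qed.

Lemma scale_exp x n : ideal_exp (ideal_scale x setT) n `<=` ideal_scale (x ^+ n) setT.
Proof.
elim: n => [|n IH]; first by move=> y _; exists y; rewrite ?expr0 ?mul1r.
rewrite [ideal_exp _ n.+1]/=; apply: mul_min; first exact/scale_ideal/idealT.
move=> _ y [u _ <-] /IH [v _ <-]; exists (u * v) => //; rewrite exprS; ring.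
Qed.

Lemma ideal_span_nil : ideal_span [set` ([::] : seq R)] = [set 0].
Proof.
rewrite eqEsubset; split; first by apply: span_min => //; apply: ideal1.
by move=> _ ->; apply: (ideal0 (span_ideal _)).
Qed.

Lemma ideal_span_cons x (s : seq R) :
  ideal_span [set` x :: s] =
  ideal_add (ideal_scale x setT) (ideal_span [set` s]).
Proof.
rewrite eqEsubset; split.
  apply: span_min; first by apply: add_ideal (span_ideal _); apply: scale_ideal idealT.
  move=> y /=; rewrite inE => /orP[/eqP->|ys].
    by apply: addl_sub; [apply: span_ideal | exists 1; rewrite ?mulr1].
  by apply: addr_sub; [exact: scale_ideal idealT | apply: span_sub].
apply: add_min; first exact: span_ideal.
  by apply: scale_sub (span_ideal _) _; apply: span_sub; rewrite /= mem_head.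
by apply: span_mono => y /= ys; rewrite inE ys orbT.
Qed.

(** The exponents of the generators add up by [exp_add_sub]. Applied to generators of m, it places a
    power of m inside an m-primary ideal. *)
Lemma span_exp_sub (s : seq R) A : ideal A ->
  (forall x, x \in s -> exists n, A (x ^+ n)) ->
  exists n, ideal_exp (ideal_span [set` s]) n `<=` A.
Proof.
move=> iA; elim: s => [_|x s IH h].
  exists 1%N; rewrite ideal_span_nil [ideal_exp _ _]/=; apply: mul_min => // _ y -> _.
  by rewrite mul0r; apply: ideal0.
have [|n hn] := IH; first by move=> y ys; apply: h; rewrite inE ys orbT.
have [p hp] := h x (mem_head _ _).
exists (p + n)%N; rewrite ideal_span_cons.
apply: subset_trans (exp_add_sub _ _) _.
- exact: scale_ideal idealT.
- exact: span_ideal.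
apply: add_min => //; apply: subset_trans (@scale_exp _ _) _.
exact: scale_sub.
Qed.

End IdealArithmetic.

Arguments idealT {R}.
Arguments ideal1 {R}.
Arguments span_ideal {R} S.
Arguments span_sub {R} S.
Arguments mul_ideal {R} A B.
Arguments exp_ideal {R} A n.

(** * Length *)

Section Length.
Variable R : comNzRingType.
Implicit Types (A B C D K N : set R) (x y : R) (F : set (set R)).

(** Strictness survives because an inclusion of [f (N i.+1)] in [f (N i)] pulls back along [g]. Used
    in both directions, it compares the lengths of isomorphic lattices of submodules. *)
Lemma chain_map F F' (f g : set R -> set R) n :
  (forall A, F A -> F' (f A)) -> {homo f : A B / A `<=` B} ->
  {homo g : A B / A `<=` B} -> (forall A, F A -> g (f A) = A) ->
  strict_chain F n -> strict_chain F' n.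
Proof.
move=> FF' fh gh gf [N [FN sN]]; exists (f \o N); split=> [i /FN|i ilt /=].
  exact: FF'.
have [h1 h2] := sN i ilt; split; first exact: fh.
by move=> /gh; rewrite !gf; [exact: h2 | apply: FN; exact: ltnW | apply: FN].
Qed.

Lemma chain_mono F F' n : F `<=` F' -> strict_chain F n -> strict_chain F' n.
Proof. by move=> FF'; apply: (@chain_map _ _ id id) => // A /FF'. Qed.

Lemma max_chain_uniq F n k :
  max_chain_length F n -> max_chain_length F k -> n = k.
Proof.
by case=> cn hn [ck hk]; apply/eqP; rewrite eqn_leq hn // hk.
Qed.

Lemma max_chain_bounded F b : F !=set0 ->
  (forall k, strict_chain F k -> (k <= b)%N) ->
  exists2 n, max_chain_length F n & (n <= b)%N.
Proof.
move=> [A FA] hb.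
have ex : exists n, `[< strict_chain F n >].
  by exists 0%N; apply/asboolP; exists (fun=> A).
have ub n : `[< strict_chain F n >] -> (n <= b)%N by move/asboolP/hb.
case: (ex_maxnP ex ub) => n /asboolP cn hn; exists n; last exact: hb.
by split=> // k /asboolP /hn.
Qed.

(** As a relation, it asserts finiteness together with the value, so that additivity can be stated
    without treating [+oo]. *)
Definition len A B n := max_chain_length (submodules (Subquot A B)) n.

Lemma mod_length_len A B n : len A B n -> mod_length (Subquot A B) = (n%:Z)%:E%E.
Proof.
move=> h; apply: xget_unique; first by exists n.
by move=> _ [k /(max_chain_uniq h) -> <-].
Qed.

(** The last term is recorded so that the chain can be prolonged by one step. *)
Definition chain_to F n X :=
  exists N : nat -> set R, [/\ forall i, (i <= n)%N -> F (N i),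
    forall i, (i < n)%N -> N i `<` N i.+1 & N n = X].

Lemma chain_toS F n X Y : chain_to F n X -> F Y -> X `<` Y -> chain_to F n.+1 Y.
Proof.
move=> [N [FN sN NX]] FY XY; exists (fun i => if (i <= n)%N then N i else Y).
split=> [i _|i|]; last by rewrite ltnn.
  by case: leqP => // /FN.
rewrite ltnS => ilen; rewrite ilen; case: ltnP => [|nlei]; first exact: sN.
have -> : i = n by lia.
by rewrite NX.
Qed.

(* Modular law: two comparable ideals with the same sum and the same
   intersection with C coincide, so each strict step stays strict in one. *)
Lemma chain_split A B C n (N : nat -> set R) :
  ideal A -> ideal C -> B `<=` C -> C `<=` A ->
  (forall i, (i <= n)%N -> submodules (Subquot A B) (N i)) ->
  (forall i, (i < n)%N -> N i `<` N i.+1) ->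
  exists p q, [/\ (n <= p + q)%N,
    chain_to (submodules (Subquot A C)) p (ideal_add (N n) C) &
    chain_to (submodules (Subquot C B)) q (N n `&` C)].
Proof.
move=> iA iC BC CA; elim: n => [|n IH] FN sN.
  exists 0%N, 0%N; split=> //.
    exists (fun=> ideal_add (N 0%N) C); split=> // i _.
    have [iN _ NA] := FN 0%N isT.
    by split=> /=; [exact: add_ideal | exact: addr_sub | exact: add_min].
  exists (fun=> N 0%N `&` C); split=> // i _.
  have [iN BN _] := FN 0%N isT.
  by split=> //=; [exact: idealI | rewrite subsetI].
have [p [q [lenpq cp cq]]] :=
  IH (fun i le => FN i (leqW le)) (fun i le => sN i (leqW le)).
have [iN BN NA] := FN n (leqnSn n).
have [iN' BN' NA'] := FN n.+1 (leqnn _).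
have [sub nsub] := sN n (ltnSn n).
have [e|ne] := pselect (ideal_add (N n.+1) C `<=` ideal_add (N n) C).
  exists p, q.+1; split; first by lia.
    suff -> : ideal_add (N n.+1) C = ideal_add (N n) C by [].
    by rewrite eqEsubset; split=> //; apply: add_mono.
  apply: chain_toS cq _ _.
    by split=> //=; [exact: idealI | rewrite subsetI].
  split; first exact: setSI.
  move=> h; apply: nsub => y yN'.
  have [u Nu [v Cv uv]] := e y (addl_sub iC yN').
  rewrite -uv; apply: idealD => //.
  suff : (N n `&` C) v by case.
  apply: h; split=> //; have -> : v = y - u by rewrite -uv addrC addKr.
  by apply: idealB => //; apply: sub.
have cp' : chain_to (submodules (Subquot A C)) p.+1 (ideal_add (N n.+1) C).
  apply: chain_toS cp _ _.
    by split=> /=; [exact: add_ideal | exact: addr_sub | exact: add_min].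
  by split=> //; apply: add_mono.
have [e|ne'] := pselect (N n.+1 `&` C `<=` N n `&` C).
  exists p.+1, q; split; [lia|exact: cp'|].
  suff -> : N n.+1 `&` C = N n `&` C by [].
  by rewrite eqEsubset; split=> //; apply: setSI.
exists p.+1, q.+1; split; [lia|exact: cp'|].
apply: chain_toS cq _ _; first by split=> //=; [exact: idealI | rewrite subsetI].
by split=> //; apply: setSI.
Qed.

Lemma chain_cat A B C p q : B `<=` C -> C `<=` A ->
  strict_chain (submodules (Subquot C B)) q ->
  strict_chain (submodules (Subquot A C)) p ->
  strict_chain (submodules (Subquot A B)) (q + p).
Proof.
move=> BC CA [Q [FQ sQ]] [P [FP sP]].
exists (fun i => if (i <= q)%N then Q i else P (i - q)%N); split=> i ile.
  case: leqP => [/FQ[iQ BQ QC]|qi]; first by split=> //; apply: subset_trans CA.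
  have [|iP CP PA] := FP (i - q)%N; first by lia.
  by split=> //; apply: subset_trans CP.
have [iq|qi] := ltnP i q; first by rewrite ltnW //; apply: sQ.
have [->|ne] := eqVneq i q; last first.
  by rewrite leqNgt ltn_neqAle eq_sym ne qi /= subSn //; apply: sP; lia.
(* At the joint the chain jumps from [Q q] to [P 1]: the term [P 0] is dropped, since it may
   coincide with [Q q]. This is why the length is q + p. *)
rewrite leqnn subSnn.
have [_ _ QC] := FQ q (leqnn q).
have [_ CP _] := FP 0%N isT.
have [|s ns] := sP 0%N; first by lia.
have QP : Q q `<=` P 0%N by apply: subset_trans CP.
split; first exact: subset_trans s.
by move=> h; apply: ns; apply: subset_trans QP.
Qed.

Lemma len_add A B C n k : ideal A -> ideal C -> B `<=` C -> C `<=` A ->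
  len A C n -> len C B k -> len A B (k + n).
Proof.
move=> iA iC BC CA [cn hn] [ck hk]; split; first exact: chain_cat ck cn.
move=> l [N [FN sN]]; have [p [q [lpq [P [FP sP _]] [Q [FQ sQ _]]]]] :=
  chain_split iA iC BC CA FN sN.
have lep : (p <= n)%N by apply: hn; exists P.
have leq : (q <= k)%N by apply: hk; exists Q.
by lia.
Qed.

Lemma len_sub A B C n : ideal A -> ideal B -> ideal C -> B `<=` C -> C `<=` A ->
  len A B n -> exists p q, [/\ len A C p, len C B q & n = (q + p)%N].
Proof.
move=> iA iB iC BC CA lAB; have [cn hn] := lAB.
have [|k ck|p lp _] := @max_chain_bounded (submodules (Subquot A C)) n.
- by exists C; split.
- by apply: hn; apply: chain_mono ck => X [iX CX XA]; split=> //=; apply: subset_trans CX.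
have [|k ck|q lq _] := @max_chain_bounded (submodules (Subquot C B)) n.
- by exists C; split.
- by apply: hn; apply: chain_mono ck => X [iX BX XC]; split=> //=; apply: subset_trans CA.
by exists p, q; split=> //; apply: max_chain_uniq lAB (len_add _ _ _ _ lp lq).
Qed.

Lemma len_refl A : ideal A -> len A A 0.
Proof.
move=> iA; split; first by exists (fun=> A); split=> // i _; split.
case=> // k [N [FN sN]].
have [_ h1 _] := FN 0%N isT; have [_ _ h2] := FN 1%N isT.
by have [_ []] := sN 0%N isT; apply: subset_trans h1.
Qed.

Definition cofin A := ideal A /\ exists n, len setT A n.

(** The default 0 at infinite colength carries no information; [cofin] accompanies every use of the
    value. *)
Definition colen A : nat := xget 0%N [set n | len setT A n].

Lemma cofin_ideal A : cofin A -> ideal A. Proof. by case. Qed.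

Lemma colenP A : cofin A -> len setT A (colen A).
Proof. by case=> _; apply: xgetPex. Qed.

Lemma colenE A n : len setT A n -> colen A = n.
Proof.
by move=> h; apply: xget_unique => // k /max_chain_uniq; apply.
Qed.

Lemma cofinS A B : cofin A -> ideal B -> A `<=` B -> cofin B.
Proof.
move=> [iA [n ln]] iB AB; split=> //.
by have [p [q [lp _ _]]] := len_sub idealT iA iB AB (@subsetT _ _) ln; exists p.
Qed.

Lemma len_colen A B : cofin A -> ideal B -> A `<=` B ->
  exists k, len B A k /\ (colen A = k + colen B)%N.
Proof.
move=> cA iB AB; have iA := cofin_ideal cA.
have [p [q [lp lq e]]] := len_sub idealT iA iB AB (@subsetT _ _) (colenP cA).
by exists q; rewrite e (colenE lp).
Qed.

Lemma colen_le A B : cofin A -> ideal B -> A `<=` B -> (colen B <= colen A)%N.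
Proof. by move=> cA iB AB; have [k [_ ->]] := len_colen cA iB AB; lia. Qed.

Lemma colen_setT : colen setT = 0%N.
Proof. exact/colenE/len_refl. Qed.

Lemma cofin_setT : cofin setT.
Proof. by split=> //; exists 0%N; apply: len_refl. Qed.

Lemma cofin_len A B n : ideal A -> cofin B -> A `<=` B -> len B A n ->
  cofin A /\ colen A = (n + colen B)%N.
Proof.
move=> iA cB AB ln.
have h := len_add idealT (cofin_ideal cB) AB (@subsetT _ _) (colenP cB) ln.
by split; [split=> //; exists (n + colen B)%N | apply: colenE].
Qed.

Lemma mod_length_colen A B : cofin A -> ideal B -> A `<=` B ->
  mod_length (Subquot B A) = ((colen A)%:Z - (colen B)%:Z)%:E%E.
Proof.
move=> cA iB AB; have [k [lk ->]] := len_colen cA iB AB.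
by rewrite (mod_length_len lk) PoszD addrK.
Qed.

(* Multiplication by x induces N / (N :&: (D : x)) ~ (x N + D) / D. *)
Lemma colen_colon N D x : cofin N -> cofin D ->
  cofin (N `&` colon D x) /\
  (colen (N `&` colon D x) + colen (ideal_add (ideal_scale x N) D) =
   colen N + colen D)%N.
Proof.
move=> cN cD; have [iN iD] := (cofin_ideal cN, cofin_ideal cD).
have iK : ideal (N `&` colon D x) by apply: idealI => //; apply: colon_ideal.
have iE : ideal (ideal_add (ideal_scale x N) D).
  by apply: add_ideal => //; apply: scale_ideal.
have DE : D `<=` ideal_add (ideal_scale x N) D by apply/addr_sub/scale_ideal.
have [k [[ck hk] eD]] := len_colen cD iE DE.
pose f C := ideal_add (ideal_scale x C) D.
pose g C := N `&` colon C x.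
have fh : {homo f : A B / A `<=` B}.
  by move=> A B AB; apply: add_mono => //; apply: scale_mono.
have gh : {homo g : A B / A `<=` B}.
  by move=> A B AB y [Ny Ay]; split=> //; apply: AB.
have gf C : submodules (Subquot N (N `&` colon D x)) C -> g (f C) = C.
  case=> /= iC KC CN; rewrite eqEsubset; split=> y.
    case=> Ny [_ [c Cc <-] [d Dd e]].
    rewrite -[y](subrK c); apply: idealD => //; apply: KC; split.
      by apply: idealB => //; apply: CN.
    by rewrite /colon /= mulrBr -e addrC addKr.
  move=> Cy; split; first exact: CN.
  by apply: addl_sub => //; exists y.
have fg C : submodules (Subquot (ideal_add (ideal_scale x N) D) D) C -> f (g C) = C.
  case=> /= iC DC CE; rewrite eqEsubset; split.
    by apply: add_min => // _ [y [_ Cy] <-].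
  move=> y Cy; have [_ [n Nn <-] [d Dd e]] := CE y Cy.
  rewrite -e; apply: add_memP => //; exists n => //; split=> //.
  by rewrite /colon /= -[_ * _](addrK d) e; apply: idealB => //; apply: DC.
have lk : len N (N `&` colon D x) k.
  split.
    apply: (@chain_map _ _ g f) ck => // C [/= iC DC CE]; split=> //=.
    - by apply: idealI => //; apply: colon_ideal.
    - exact: gh.
    - exact: subIsetl.
  move=> l cl; apply: hk.
  apply: (@chain_map _ _ f g) cl => // C [/= iC DC CE]; split=> //=.
  - by apply: add_ideal => //; apply: scale_ideal.
  - exact: addr_sub (scale_ideal _ _).
  - exact: fh.
have [? ->] := cofin_len iK cN (@subIsetl _ _ _) lk.
by split=> //; lia.
Qed.

Lemma colen_colonT D x : cofin D ->
  (colen (colon D x) + colen (ideal_add (ideal_scale x setT) D) = colen D)%N.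
Proof.
move=> cD; have [_] := colen_colon x cofin_setT cD.
by rewrite setTI colen_setT.
Qed.

End Length.

(** * Noetherian rings *)

(** The basis theorem and the Rees algebra argument both produce ascending chains, so the Noetherian
    property is transported in this form. *)
Definition acc (R : comNzRingType) : Prop :=
  forall N : nat -> set R, (forall i, ideal (N i)) ->
  (forall i, N i `<=` N i.+1) -> exists k, forall n, (k <= n)%N -> N n `<=` N k.

Lemma chain_le (T : Type) (N : nat -> set T) :
  (forall i, N i `<=` N i.+1) -> {homo N : i j / (i <= j)%N >-> i `<=` j}.
Proof.
move=> h i j /subnKC <-; elim: (j - i)%N => [|k IH]; first by rewrite addn0.
by rewrite addnS; apply: subset_trans (h _).
Qed.

Lemma noetherian_acc (R : comNzRingType) : noetherian R -> acc R.
Proof.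
move=> noeth N iN asc; have le := chain_le asc.
pose U : set R := [set x | exists i, N i x].
have iU : ideal U.
  split=> [|x y [i Nx] [j Ny]|c x [i Nx]].
  - by exists 0%N; apply: ideal0.
  - exists (maxn i j); apply: idealD => //.
      by apply: le Nx; apply: leq_maxl.
    by apply: le Ny; apply: leq_maxr.
  - by exists i; apply: idealMl.
have [s eU] := noeth U iU.
suff [k hk] : exists k, [set` s] `<=` N k.
  exists k => n _ x Nx; have : U x by exists n.
  by rewrite eU; apply: span_min.
have : forall x, x \in s -> U x by move=> x xs; rewrite eU; apply: span_sub.
elim: s {eU} => [_|x s IH h]; first by exists 0%N.
have [|k hk] := IH; first by move=> y ys; apply: h; rewrite inE ys orbT.
have [i Ni] := h x (mem_head _ _).
exists (maxn i k) => y /=; rewrite inE => /orP[/eqP->|/hk].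
  by apply: le Ni; apply: leq_maxl.
by apply: le; apply: leq_maxr.
Qed.

Lemma acc_maximal (R : comNzRingType) (P : set (set R)) :
  acc R -> (forall A, P A -> ideal A) -> P !=set0 ->
  exists2 A, P A & forall B, P B -> A `<=` B -> B `<=` A.
Proof.
move=> hacc iP [A0 PA0]; apply: contrapT => noA.
have step A : exists B, P A -> P B /\ A `<` B.
  have [PA|nPA] := pselect (P A); last by exists A.
  apply: contrapT => noB; apply: noA; exists A => // B PB AB.
  by apply: contrapT => nBA; apply: noB; exists B.
have [g gP] := choice step.
have PN i : P (iter i g A0) by elim: i => //= i /gP[].
have sN i : iter i g A0 `<` iter i.+1 g A0 by have [] := gP _ (PN i).
have [|i|k hk] := hacc (fun i => iter i g A0).
- by move=> i; apply/iP/PN.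
- by have [] := sN i.
- by have [_ []] := sN k; apply: hk.
Qed.

(** * Hilbert's basis theorem through ideals of leading coefficients *)

Section Hilbert_basis.
Variable S : comNzRingType.

Definition lead_ideal (A : set {poly S}) (d : nat) : set S :=
  [set c | exists p : {poly S}, [/\ A p, (size p <= d.+1)%N & p`_d = c]].

Lemma lead_ideal_ideal A d : ideal A -> ideal (lead_ideal A d).
Proof.
move=> iA; split.
- by exists 0; split; [exact: ideal0 | rewrite size_poly0 | rewrite coef0].
- move=> _ _ [p [Ap sp <-]] [q [Aq sq <-]]; exists (p + q); split.
  + exact: idealD.
  + by apply: leq_trans (size_polyD _ _) _; rewrite geq_max sp.
  + by rewrite coefD.
- move=> c _ [p [Ap sp <-]]; exists (c%:P * p); split.
  + exact: idealMl.
  + by rewrite mul_polyC; apply: leq_trans (size_scale_leq _ _) sp.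
  + by rewrite coefCM.
Qed.

Lemma lead_idealS A d : ideal A -> lead_ideal A d `<=` lead_ideal A d.+1.
Proof.
move=> iA _ [p [Ap sp <-]]; exists ('X * p); split; first exact: idealMl.
  by apply: leq_trans (size_polyMleq _ _) _; rewrite size_polyX.
by rewrite coefXM.
Qed.

Lemma lead_ideal_mono A B d : A `<=` B -> lead_ideal A d `<=` lead_ideal B d.
Proof. by move=> AB c [p [/AB Bp sp pd]]; exists p. Qed.

(** An element of B loses its top coefficient on subtracting a suitable element of A; induction on
    the size. *)
Lemma lead_ideal_eq A B : ideal A -> ideal B -> A `<=` B ->
  (forall d, lead_ideal B d `<=` lead_ideal A d) -> B `<=` A.
Proof.
move=> iA iB AB h p; move: {2}(size p) (leqnn (size p)) => n.
elim: n p => [|n IH] p.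
  by rewrite leqn0 size_poly_eq0 => /eqP-> _; apply: ideal0.
move=> sp Bp.
have [|q [Aq sq qn]] := h n p`_n; first by exists p.
rewrite -[p](subrK q); apply: idealD => //; apply: IH; last first.
  by apply: idealB => //; apply: AB.
apply/leq_sizeP => j; rewrite leq_eqVlt => /orP[/eqP<-|lt].
  by rewrite coefB qn subrr.
rewrite coefB !nth_default ?subrr //.
  exact: leq_trans sq lt.
exact: leq_trans sp lt.
Qed.

(** The diagonal chain [lead_ideal (N i) i] becomes stationary at some k0, which settles all degrees
    from k0 on. The finitely many smaller degrees become stationary one by one. *)
Lemma acc_poly : acc S -> acc {poly S}.
Proof.
move=> hacc N iN asc; have le := chain_le asc.
have led n : {homo lead_ideal (N n) : i j / (i <= j)%N >-> i `<=` j}.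
  by apply: chain_le => i; apply: lead_idealS.
have [|i|k0 h0] := hacc (fun i => lead_ideal (N i) i).
- by move=> i; apply: lead_ideal_ideal.
- by apply: subset_trans (lead_ideal_mono (asc i)); apply: lead_idealS.
have /choice[kd hd] : forall d, exists k, forall n, (k <= n)%N ->
    lead_ideal (N n) d `<=` lead_ideal (N k) d.
  move=> d; apply: hacc (fun i => lead_ideal (N i) d) _ _ => i.
    exact: lead_ideal_ideal.
  exact: lead_ideal_mono.
pose k := maxn k0 (\max_(d < k0) kd d).
exists k => n kn; apply: lead_ideal_eq (iN _) (iN _) (le _ _ kn) _ => d.
have k0k : (k0 <= k)%N by apply: leq_maxl.
have [dk|kd'] := ltnP d k0.
  have kdk : (kd d <= k)%N.
    apply: leq_trans (leq_maxr _ _).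
    exact: (@leq_bigmax _ (fun i : 'I_k0 => kd i) (Ordinal dk)).
  apply: subset_trans (hd d n (leq_trans kdk kn)) _.
  exact/lead_ideal_mono/le.
apply: (@subset_trans _ (lead_ideal (N k0) k0)); last first.
  by apply: subset_trans (led _ _ _ kd') (lead_ideal_mono (le _ _ k0k)).
apply: subset_trans (h0 (maxn d n) _); last by rewrite leq_max kd'.
apply: subset_trans (led _ _ _ (leq_maxl _ _)) _.
exact: (lead_ideal_mono (le _ _ (leq_maxr _ _))).
Qed.

End Hilbert_basis.

(** * Local rings: units, a Nakayama lemma, finite colength of the powers of m *)

Section Local.
Variables (R : comNzRingType) (m : set R).
Implicit Types (A : set R) (x y u : R).

Lemma maximal_comax r : maximal_ideal m -> ~ m r ->
  exists s t, m t /\ s * r + t = 1.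
Proof.
move=> [[im m1] mmax] mr.
have iA : ideal (ideal_add (ideal_scale r setT) m).
  by apply: add_ideal => //; apply: scale_ideal idealT.
have [[_ [s _ <-] [t mt e]]|A1] :=
    pselect (ideal_add (ideal_scale r setT) m 1).
  by exists s, t; rewrite mulrC.
case: mr; rewrite -(mmax _ (conj iA A1)); last exact/addr_sub/scale_ideal/idealT.
by apply: addl_sub => //; exists 1; rewrite ?mulr1.
Qed.

(** Otherwise 1 - u lies in a maximal ideal, obtained from the ascending chain condition. It is m,
    which then contains 1. *)
Lemma unit_1B u : noetherian_local m -> m u -> exists v : R, v * (1 - u) = 1.
Proof.
move=> [noeth mmax muniq] mu; apply: contrapT => nu.
pose P : set (set R) := [set A : set R | Defs.proper_ideal A /\ A (1 - u)].
have [||M [[iM M1] Mu] Mmax] := @acc_maximal R P (noetherian_acc noeth).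
- by move=> A [[]].
- exists (ideal_scale (1 - u) setT); split; last by exists 1; rewrite ?mulr1.
  split; first exact: scale_ideal idealT.
  by case=> v _ e; apply: nu; exists v; rewrite mulrC.
have eM : M = m.
  apply: muniq; split=> // A [iA A1] MA; rewrite eqEsubset; split=> //.
  by apply: Mmax => //; split=> //; apply: MA.
by apply: M1; rewrite -(subrK u 1); apply: idealD => //; rewrite eM.
Qed.

(* Every y in V is x^n y_n with y_n in V; the ideals of those z in V with
   x^n z in (y) ascend with n, and y_(k+1) in the k-th one gives
   (1 - c x) x^k y_(k+1) = 0. *)
Lemma nakayama1 (V : set R) x : noetherian_local m -> m x -> ideal V ->
  (forall y, V y -> exists2 z, V z & y = x * z) -> V `<=` [set 0].
Proof.
move=> loc mx iV onto y Vy; have [noeth _ _] := loc.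
have onton n : exists2 z, V z & y = x ^+ n * z.
  elim: n => [|n [z /onto[z' Vz' ->] ->]]; first by exists y; rewrite ?expr0 ?mul1r.
  by exists z'; rewrite // exprSr mulrA.
pose N n : set R := [set z | V z /\ exists c, x ^+ n * z = c * y].
have [n|n z [Vz [c e]]|k hk] := noetherian_acc noeth (N := N).
- split=> [|z z' [Vz [c e]] [Vz' [c' e']]|r z [Vz [c e]]].
  + by split; [exact: ideal0 | exists 0; rewrite mulr0 mul0r].
  + by split; [exact: idealD | exists (c + c'); rewrite mulrDr e e' mulrDl].
  + by split; [exact: idealMl | exists (r * c); rewrite -mulrA -e; ring].
- by split=> //; exists (x * c); rewrite exprS -mulrA e mulrA.
have [z Vz ez] := onton k.+1.
have [|_ [c e]] := hk k.+1 (leqnSn k) z; first by split=> //; exists 1; rewrite mul1r.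
have [|v hv] := @unit_1B (c * x) loc.
  by case: loc => _ [[im _] _] _; apply: idealMl.
have xA : x * (x ^+ k * z) = y by rewrite mulrA -exprS -ez.
have e0 : x ^+ k * z = 0.
  by rewrite -[LHS]mul1r -hv -mulrA mulrBl mul1r -(mulrA c) xA -e subrr mulr0.
by rewrite /= -xA e0 mulr0.
Qed.

(** The quotient ((g) + A)/A is a vector space over R/m of dimension at most one. Concretely, the
    middle term of a chain of length two contains some r g + a with r outside m; inverting r modulo
    m puts g in that term, which is then everything. *)
Lemma cofin_step A g : maximal_ideal m -> ideal A ->
  (forall x, m x -> A (x * g)) ->
  cofin (ideal_add (ideal_scale g setT) A) -> cofin A.
Proof.
move=> mmax iA mg cB; set B := ideal_add _ _ in cB.
have AB : A `<=` B by apply/addr_sub/scale_ideal/idealT.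
have [||n ln _] := @max_chain_bounded R (submodules (Subquot B A)) 1.
- by exists A; split.
- case=> [//|[//|k]] [N [FN sN]]; exfalso.
  have [_ AN0 _] := FN 0%N isT; have [iN1 _ N1B] := FN 1%N isT.
  have [_ _ N2B] := FN 2 isT.
  have [_ ns0] := sN 0%N isT; have [_ ns1] := sN 1%N isT.
  suff BN1 : B `<=` N 1%N by apply: ns1; apply: subset_trans BN1.
  have [y [N1y nAy]] : exists y, N 1%N y /\ ~ A y.
    apply: contrapT => no; apply: ns0 => y N1y; apply: AN0.
    by apply: contrapT => nAy; apply: no; exists y.
  have AN1 : A `<=` N 1%N by apply: subset_trans AN0 _; case: (sN 0%N isT).
  apply: add_min => //; apply: scale_sub => //.
  have [_ [r _ <-] [a Aa e]] := N1B y N1y.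
  have [|s [t [mt st]]] := @maximal_comax r mmax.
    by move=> mr; apply: nAy; rewrite -e mulrC; apply: idealD => //; apply: mg.
  have -> : g = s * (y - a) + t * g by rewrite -e -[LHS]mul1r -st; ring.
  apply: idealD => //; last exact/AN1/mg.
  by apply: idealMl => //; apply: idealB => //; apply: AN1.
by have [] := cofin_len iA cB AB ln.
Qed.

(** The module m^k/m^(k+1) is finitely generated and killed by m; its generators are removed one at
    a time by [cofin_step]. *)
Lemma cofin_exp k : noetherian R -> maximal_ideal m -> cofin (ideal_exp m k).
Proof.
move=> noeth mmax; elim: k => [|k IH]; first exact: cofin_setT.
have [s es] := noeth _ (exp_ideal m k).
suff gen (t : seq R) A : ideal A -> (forall x g, m x -> g \in t -> A (x * g)) ->
    cofin (ideal_add (ideal_span [set` t]) A) -> cofin A.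
  apply: (gen s); first exact: exp_ideal.
    move=> x g mx gs; apply: (@mul_memP _ m (ideal_exp m k)) => //.
    by rewrite es; apply: span_sub.
  rewrite -es; apply: cofinS IH _ _; last exact: addl_sub (exp_ideal _ _).
  by apply: add_ideal; apply: exp_ideal.
elim: t A => [|g t IHt] A iA h c.
  apply: (cofinS c iA); rewrite ideal_span_nil; apply: (add_min iA) => // _ ->.
  exact: ideal0.
have iB : ideal (ideal_add (ideal_scale g setT) A).
  by apply: add_ideal => //; apply: scale_ideal idealT.
have AB : A `<=` ideal_add (ideal_scale g setT) A.
  exact/addr_sub/scale_ideal/idealT.
apply: (@cofin_step A g) => //; first by move=> x mx; apply: h => //; apply: mem_head.
apply: IHt => //.
  by move=> x y mx yt; apply: AB; apply: h => //; rewrite inE yt orbT.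
apply: cofinS c _ _; first by apply: add_ideal (span_ideal _) iB.
rewrite ideal_span_cons; apply: add_min; first exact: add_ideal (span_ideal _) iB.
  apply: add_min; first exact: add_ideal (span_ideal _) iB.
    apply: subset_trans (addr_sub (span_ideal _)); exact: addl_sub iA.
  exact: addl_sub iB.
by apply: subset_trans AB (addr_sub (span_ideal _)).
Qed.

End Local.

(** * Rees algebras and Hilbert functions *)

Section Rees.
Variables (R : comNzRingType) (J : set R).
Hypothesis iJ : ideal J.

Definition rees : set {poly R} := [set p : {poly R} | forall n, ideal_exp J n p`_n].

Lemma reesC c : rees c%:P.
Proof. by move=> [|n]; rewrite coefC //=; apply: (ideal0 (mul_ideal _ _)). Qed.

Lemma rees_mono x n : ideal_exp J n x -> rees (x *: 'X^n).
Proof.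
move=> Jx k; rewrite coefZ coefXn.
have [->|_] := eqVneq k n; first by rewrite mulr1.
by rewrite mulr0; apply: (ideal0 (exp_ideal _ _)).
Qed.

Lemma reesM p q : rees p -> rees q -> rees (p * q).
Proof.
move=> hp hq n; rewrite coefM; apply: (ideal_sum _ (exp_ideal _ _)) => i _.
rewrite -[X in ideal_exp J X](@subnKC i n) ?expD; last by rewrite -ltnS.
exact: mul_memP.
Qed.

Lemma rees_sum (T : Type) (s : seq T) (F : T -> {poly R}) :
  (forall i, rees (F i)) -> rees (\sum_(i <- s) F i).
Proof.
move=> h n; rewrite coef_sum; apply: (ideal_sum _ (exp_ideal _ _)) => i _.
exact: h.
Qed.

(** [S] is an iterated polynomial ring over R with one variable for each element x of [xs], sent by
    [phi] to x X. Chains of graded ideals are pulled back to [S], where the basis theorem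
    applies. *)
Lemma rees_gen (xs : seq R) : acc R -> [set` xs] `<=` J ->
  exists (S : comNzRingType) (phi : {rmorphism S -> {poly R}}),
  [/\ acc S, forall c, exists s, phi s = c%:P,
      forall x, x \in xs -> exists s, phi s = x *: 'X & forall s, rees (phi s)].
Proof.
move=> accR; elim: xs => [_|x xs IH xsJ].
  exists R, polyC; split=> // [c|c]; first by exists c.
  exact: reesC.
have [|S [phi [accS hC hX hrees]]] := IH.
  by move=> y /= ys; apply: xsJ; rewrite /= inE ys orbT.
have cphi : commr_rmorph phi (x *: 'X) by move=> s; apply: mulrC.
exists {poly S}, (horner_morph cphi); split=> [||y|p].
- exact: acc_poly.
- by move=> c; have [s <-] := hC c; exists s%:P; rewrite /= horner_morphC.
- rewrite inE => /orP[/eqP->|/hX[s <-]]; first by exists 'X; rewrite /= horner_morphX.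
  by exists s%:P; rewrite /= horner_morphC.
rewrite /= /horner_morph horner_coef; apply: rees_sum => i; rewrite coef_map.
apply: reesM; first exact: hrees.
elim: (nat_of_ord i) => [|k IHk]; first by rewrite expr0; apply: reesC.
rewrite exprS; apply: reesM => //; rewrite -['X]expr1; apply: rees_mono.
by rewrite /= mul_comm mul_setT //; apply: xsJ; rewrite /= mem_head.
Qed.

Variable xs : seq R.
Hypotheses (accR : acc R) (eJ : J = ideal_span [set` xs]).

(* The ideals of the Rees algebra with components N_n for n <= e and D_n for
   n > e ascend with e. *)
Lemma graded_nilpotent (N D : nat -> set R) :
  (forall n, ideal (N n)) -> (forall n, ideal (D n)) ->
  (forall n, D n `<=` N n) -> (forall n, N n `<=` ideal_exp J n) ->
  (forall n x y, x \in xs -> N n y -> D n.+1 (x * y)) ->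
  exists k, forall n, (k < n)%N -> N n `<=` D n.
Proof.
move=> iN iD DN NJ h.
have hJ n x y : J x -> N n y -> D n.+1 (x * y).
  move=> + Ny; rewrite eJ mulrC; apply: (span_min (colon_ideal _ (iD _))).
  by move=> z /= zx; rewrite /colon /= mulrC; apply: h.
have xsJ : [set` xs] `<=` J by rewrite eJ; apply: span_sub.
have [S [phi [accS hC hX hrees]]] := rees_gen accR xsJ.
have phi_onto n y : ideal_exp J n y -> exists s, phi s = y *: 'X^n.
  elim: n y => [|n IH] y Jy.
    by have [s es] := hC y; exists s; rewrite es expr0 alg_polyC.
  pose B n : set R := [set z | exists s, phi s = z *: 'X^n].
  have iB k : ideal (B k).
    split=> [|u v [s es] [t et]|c u [s es]].
    - by exists 0; rewrite rmorph0 scale0r.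
    - by exists (s + t); rewrite rmorphD es et scalerDl.
    - have [t et] := hC c; exists (t * s).
      by rewrite rmorphM es et mul_polyC scalerA.
  have JB : J `<=` B 1%N by rewrite eJ; apply: span_min => // x /hX.
  suff: ideal_exp J n.+1 `<=` B n.+1 by apply.
  rewrite [ideal_exp _ _]/=; apply: mul_min => // u v /JB[s es] /IH[t et].
  exists (s * t); rewrite rmorphM es et -scalerAl -scalerAr scalerA.
  by rewrite -exprD.
pose E e n := if (n <= e)%N then N n else D n.
have iE e n : ideal (E e n) by rewrite /E; case: ifP.
have EN e n : E e n `<=` N n by rewrite /E; case: ifP => _; [|exact: DN].
have DE e n : D n `<=` E e n by rewrite /E; case: ifP => _; [exact: DN|].
(* The mixed family is stable under the Rees algebra because a factor from J sends N into D, and D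
   lies in every [E e]. *)
have EJ e i n x y : ideal_exp J i x -> E e n y -> E e (i + n)%N (x * y).
  move=> + Ey; elim: i x => [|i IH] x; first by move=> _; apply: idealMl.
  suff : ideal_exp J i.+1 `<=` colon (E e (i.+1 + n)%N) y.
    by move=> hh /hh; rewrite /colon /= mulrC.
  rewrite [ideal_exp _ _]/=; apply: mul_min; first exact: colon_ideal.
  move=> u v Ju /IH /EN /(hJ _ _ _ Ju) Dv.
  by rewrite /colon /= mulrC -mulrA; apply: DE.
pose P e : set S := [set s | forall n, E e n (phi s)`_n].
have [e|e s h' n|k hk] := accS P.
- split=> [n|s t hs ht n|c s hs n].
  + by rewrite rmorph0 coef0; apply: ideal0.
  + by rewrite rmorphD coefD; apply: idealD.
  + rewrite rmorphM coefM; apply: ideal_sum => // i _.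
    rewrite -[X in E e X](@subnKC i n); last by rewrite -ltnS.
    by apply: EJ => //; apply: hrees.
- move: (h' n); rewrite /E; case: leqP => [ne|_]; first by rewrite (leqW ne).
  by case: ifP => // _; apply: DN.
(* A preimage of y X^n lies in [P n], hence in [P k], whose component in degree n > k is D. *)
exists k => n kn y Ny; have [s es] := phi_onto n y (NJ _ _ Ny).
have := hk n (ltnW kn) s _ n; rewrite /E leqNgt kn /= es coefZ coefXn eqxx mulr1.
apply=> i; rewrite es coefZ coefXn; have [->|_] := eqVneq i n.
  by rewrite mulr1 /E leqnn.
by rewrite mulr0; apply: ideal0.
Qed.

End Rees.

(** * Eventual properties and iterated differences of integer sequences *)

Definition eventually (P : nat -> Prop) : Prop :=
  exists N : nat, forall n, (N <= n)%N -> P n.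

Lemma eventually_and P Q : eventually P -> eventually Q ->
  eventually (fun n => P n /\ Q n).
Proof.
move=> [N hN] [M hM]; exists (maxn N M) => n; rewrite geq_max => /andP[? ?].
by split; [apply: hN | apply: hM].
Qed.

Section Differences.
Implicit Types (u v : nat -> int).

Definition dif u : nat -> int := fun n => u n.+1 - u n.

Lemma iter_difB k u v n :
  iter k dif (fun n => u n - v n) n = iter k dif u n - iter k dif v n.
Proof.
by elim: k n => //= k IH n; rewrite /dif !IH; ring.
Qed.

Lemma iter_dif_shift k u n : iter k dif (fun n => u n.+1) n = iter k dif u n.+1.
Proof. by elim: k n => //= k IH n; rewrite /dif !IH. Qed.

Lemma dif_const u c N : (forall n, (N <= n)%N -> dif u n = c) ->
  forall n, u (N + n)%N = u N + c * n%:Z.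
Proof.
move=> h; elim=> [|n IH]; first by rewrite addn0 mulr0 addr0.
have := h (N + n)%N (leq_addr _ _); rewrite /dif addnS => e.
have -> : u (N + n).+1 = u (N + n)%N + c by rewrite -e; ring.
rewrite IH; lia.
Qed.

(** A bounded polynomial sequence is constant. The differences are bounded by 2b, so by induction
    they are eventually constant, and [u] is eventually linear; boundedness then kills the slope. *)
Lemma bounded_dif_eq0 k u (b : int) :
  eventually (fun n => `|u n| <= b) -> eventually (fun n => iter k dif u n = 0) ->
  eventually (fun n => dif u n = 0).
Proof.
elim: k u b => [|k IH] u b bd h.
  by case: h => N h; exists N => n Nn; rewrite /dif /= in h *; rewrite !h // leqW.
have [||N hN] := IH (dif u) (b + b).
- case: bd => N hN; exists N => n Nn; rewrite /dif.
  by have := hN n Nn; have := hN n.+1 (leqW Nn); lia.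
- by case: h => N hN; exists N => n /hN; rewrite iterSr.
case: bd => M hM; pose K := maxn N M.
have NK : (N <= K)%N by apply: leq_maxl.
have MK : (M <= K)%N by apply: leq_maxr.
have cst n : (K <= n)%N -> dif u n = dif u K.
  move=> /subnKC <-; elim: (n - K)%N => [|i IHi]; first by rewrite addn0.
  have := hN (K + i)%N; rewrite {1}/dif IHi addnS => /(_ _)/subr0_eq-> //.
  exact: leq_trans NK (leq_addr _ _).
have lin := dif_const cst.
suff e0 : dif u K = 0 by exists K => n Kn; rewrite cst.
have b0 : 0 <= b by have := hM K MK; lia.
case: b b0 hM => // b _ hM.
have h2 := hM K MK.
(* A nonzero integral slope moves [u] by at least 2b + 1 over this many steps, but two values of
   size at most b differ by at most 2b. *)
have := hM (K + (b + b).+1)%N (leq_trans MK (leq_addr _ _)).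
rewrite lin => h1; apply: contrapT => /eqP ne.
have : (b + b).+1%:Z <= `|dif u K * (b + b).+1%:Z|.
  by rewrite normrM; apply: ler_peMl => //; rewrite -gtz0_ge1 normr_gt0.
lia.
Qed.

End Differences.

(** * The Hilbert-Serre theorem for graded subquotients of the Rees algebra *)

Section HilbertSerre.
Variables (R : comNzRingType) (J : set R) (xs : seq R).
Hypotheses (accR : acc R) (eJ : J = ideal_span [set` xs]).
Implicit Types (N D : nat -> set R).

Definition hilb N D n : int := (colen (D n))%:Z - (colen (N n))%:Z.

(** [l] lists the generators of J not yet known to kill N/D. Multiplication by its head x on N/D has
    kernel K/D and cokernel N/E, both killed by x, and the first difference of the Hilbert function
    of N/D is the difference of theirs, the cokernel being taken one degree higher. When [l] is
    empty, [graded_nilpotent] makes N/D vanish in large degrees. *)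
Lemma hilbert_serre (l : seq R) N D :
  (forall n, ideal (N n)) -> (forall n, cofin (D n)) ->
  (forall n, D n `<=` N n) -> (forall n, N n `<=` ideal_exp J n) ->
  (forall n x y, J x -> N n y -> N n.+1 (x * y)) ->
  (forall n x y, J x -> D n y -> D n.+1 (x * y)) ->
  {subset l <= xs} ->
  (forall n x y, x \in xs -> x \notin l -> N n y -> D n.+1 (x * y)) ->
  eventually (fun n => iter (size l) dif (hilb N D) n = 0).
Proof.
have iJ : ideal J by rewrite eJ; apply: span_ideal.
elim: l N D => [|x l IH] N D iN cD DN NJ JN JD lxs kill.
  have [n|n x y xx Ny|k hk] := graded_nilpotent iJ accR eJ iN _ DN NJ.
  - exact: cofin_ideal.
  - exact: kill.
  exists k.+1 => n kn; rewrite /= /hilb.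
  by have -> : N n = D n; [rewrite eqEsubset; split=> //; apply: hk | rewrite subrr].
have iD n := cofin_ideal (cD n).
have cN n : cofin (N n) := cofinS (cD n) (iN n) (DN n).
have Jx : J x by rewrite eJ; apply: span_sub; rewrite /= lxs // mem_head.
pose K n := N n `&` colon (D n.+1) x.
(* No product by x lands in degree 0, so the cokernel there is all of N/D. *)
pose E n := if n is n'.+1 then ideal_add (ideal_scale x (N n')) (D n) else D n.
have iK n : ideal (K n) by apply: idealI => //; apply: colon_ideal.
have iE n : ideal (E n).
  by case: n => //= n; apply: add_ideal => //; apply: scale_ideal.
have DK n : D n `<=` K n by move=> y Dy; split; [exact: DN | exact: JD].
have DE n : D n `<=` E n by case: n => //= n; apply: addr_sub; apply: scale_ideal.
have EN n : E n `<=` N n.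
  case: n => [|n] /=; first exact: DN.
  by apply: add_min => // _ [y Ny <-]; apply: JN.
have lxs' : {subset l <= xs} by move=> y yl; apply: lxs; rewrite inE yl orbT.
have hK : eventually (fun n => iter (size l) dif (hilb K D) n = 0).
  apply: IH => //.
  - by move=> n y [/NJ].
  - move=> n y z Jy [Nz Dz]; split; first exact: JN.
    by rewrite /colon /= mulrCA; apply: JD.
  - move=> n y z yxs yl [Nz Dz]; have [->|ne] := eqVneq y x; first exact: Dz.
    by apply: kill => //; rewrite inE negb_or ne.
have hE : eventually (fun n => iter (size l) dif (hilb N E) n = 0).
  apply: IH => //.
  - by move=> n; apply: cofinS (cD n) (iE n) (DE n).
  - move=> [|n] y z Jy /=.
      by move=> Dz; apply: (@DE 1%N); apply: JD.
    move=> [_ [u Nu <-] [v Dv <-]]; rewrite mulrDr mulrCA; apply: add_memP.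
      by exists (y * u) => //; apply: JN.
    exact: JD.
  - move=> n y z yxs yl Nz; have [->|ne] := eqVneq y x.
      by apply: addl_sub => //; exists z.
    by apply: DE; apply: kill => //; rewrite inE negb_or ne.
have [M hM] := eventually_and hK hE; exists M => n Mn; rewrite [size _]/= iterSr.
rewrite (_ : dif _ = fun n => hilb N E n.+1 - hilb K D n); last first.
  apply/funext => i; rewrite /dif /hilb /E.
  have [_] := colen_colon x (cN i) (cD i.+1); rewrite -/(K i); lia.
rewrite iter_difB iter_dif_shift.
by have [-> _] := hM n Mn; have [_ ->] := hM n.+1 (leqW Mn).
Qed.

End HilbertSerre.

(** * Regular sequences and joint reductions *)

Section Koszul.
Variable R : comNzRingType.
Implicit Types (a b x y z : R).

(* Exactness of the Koszul complex of (a, b) in degree one. *)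
Definition koszul_exact a b : Prop :=
  forall y w, a * y + b * w = 0 -> exists t, y = t * b /\ w = - (t * a).

Lemma koszul_exactC a b : koszul_exact a b -> koszul_exact b a.
Proof.
move=> h y w; rewrite addrC => /h[t [-> ->]]; exists (- t).
by rewrite !mulNr opprK.
Qed.

(** Powers of x are treated by cancelling one x at a time, powers of z by iterating the result. *)
Lemma regular_seq_pow x z k l :
  (forall y, x * y = 0 -> y = 0) ->
  (forall y t, z * y = x * t -> exists t', y = x * t') ->
  (forall y, x ^+ k * y = 0 -> y = 0) /\
  (forall y t, z ^+ l * y = x ^+ k * t -> exists t', y = x ^+ k * t').
Proof.
move=> hx hz.
have hxk n y : x ^+ n * y = 0 -> y = 0.
  elim: n y => [|n IH] y; first by rewrite mul1r.
  by rewrite exprSr -mulrA => /IH /hx.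
split; first exact: hxk.
have hzk n y t : z * y = x ^+ n * t -> exists t', y = x ^+ n * t'.
  elim: n y t => [|n IH] y t; first by exists y; rewrite mul1r.
  rewrite exprS -mulrA => e; have [y' ey] := hz _ _ e.
  have [t' et'] : exists t', y' = x ^+ n * t'.
    apply: (IH _ t); apply/eqP; rewrite -subr_eq0; apply/eqP/hx.
    by rewrite mulrBr -e ey; ring.
  by exists t'; rewrite ey et' mulrA.
elim: l => [|l IH] y t; first by exists t; rewrite -[LHS]mul1r.
by rewrite exprS -mulrA => /hzk[t' /IH].
Qed.

(* The homology of the Koszul complex of (a, b) is killed by (a, b), hence by
   the regular sequence x, z. *)
Lemma koszul_regular a b x z :
  (forall y, x * y = 0 -> y = 0) ->
  (forall y t, z * y = x * t -> exists t', y = x * t') ->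
  (exists u v, x = u * a + v * b) -> (exists u v, z = u * a + v * b) ->
  koszul_exact a b.
Proof.
move=> hx hz [u [v ex]] [u' [v' ez]] y w e.
have xinj p q : x * p = x * q -> p = q.
  by move=> epq; apply/eqP; rewrite -subr_eq0; apply/eqP/hx; rewrite mulrBr epq subrr.
have ew : b * w = - (a * y) by rewrite -[LHS](addKr (a * y)) e addr0.
(* Contracting the cycle (y, w) with the coefficients of x gives b t0 = x y and a t0 = - x w. Once
   t0 is divisible by x, the quotient is the required t. *)
pose t0 := v * y - u * w.
have e1 : b * t0 = x * y.
  have -> : b * t0 = v * b * y - u * (b * w) by rewrite /t0; ring.
  by rewrite ew ex; ring.
have e2 : a * t0 = - (x * w).
  have -> : a * t0 = v * (a * y) - u * a * w by rewrite /t0; ring.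
  by rewrite -[a * y]opprK -ew ex; ring.
have [|t et] := hz t0 (v' * y - u' * w).
  have -> : z * t0 = u' * (a * t0) + v' * (b * t0) by rewrite ez; ring.
  by rewrite e1 e2; ring.
exists t; split; apply: xinj; first by rewrite -e1 et; ring.
by rewrite -[LHS]opprK -e2 et; ring.
Qed.

(** If b z = 0, then (0, z) is a cycle, so z is a multiple of a by an element of (0 : b). Thus a (0
    : b) = (0 : b), and Nakayama applies. *)
Lemma koszul_nzd (m : set R) a b : noetherian_local m -> m a ->
  koszul_exact a b -> forall y, b * y = 0 -> y = 0.
Proof.
move=> loc ma hab y hy; apply: (@nakayama1 R m (colon [set 0] b) a) => //.
  exact: colon_ideal ideal1.
move=> z /= bz; have [|t [e1 ->]] := hab 0 z; first by rewrite mulr0 add0r.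
by exists (- t); rewrite /colon /= ?mulrN 1?mulrC // -e1 oppr0.
Qed.

Lemma cm2_koszul (m : set R) a b k : cohen_macaulay_local m -> krull_dim R 2 ->
  ideal_exp m k `<=` ideal_add (ideal_scale a setT) (ideal_scale b setT) ->
  koszul_exact a b.
Proof.
move=> [_ [d dimd [[s [[reg _] sm] sized] _]]] dim2 hk.
have d2 : d = 2%N := max_chain_uniq dimd dim2.
move: reg sm; rewrite d2 in sized.
case: s sized => [|x [|z [|]]] // _ reg sm.
have hx y : x * y = 0 -> y = 0.
  have := reg 0%N isT y; rewrite /= ideal_span_nil; exact.
have hz y t : z * y = x * t -> exists t', y = x * t'.
  have := reg 1%N isT y; rewrite /= ideal_span_cons ideal_span_nil.
  move=> hreg e; have [|_ [t' _ <-] [_ -> <-]] := hreg.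
    by exists (x * t); [exists t | exists 0; rewrite ?addr0 ?e].
  by exists t'; rewrite addr0.
have [hxk hzk] := regular_seq_pow k k hx hz.
have inab y : m y -> exists u v, y ^+ k = u * a + v * b.
  move=> my; have [_ [u _ <-] [_ [v _ <-] <-]] := hk _ (exp_memX k my).
  by exists u, v; rewrite [u * a]mulrC [v * b]mulrC.
apply: (koszul_regular hxk hzk); apply: inab; apply: sm; rewrite /= !inE eqxx ?orbT //.
Qed.

End Koszul.

(** * The bigraded filtration I^r J^s and ideals containing a power of m *)

Section Bipower.
Variable R : comNzRingType.
Implicit Types (I J A m : set R) (a b x y : R).

Lemma bipower_ideal I J r s : ideal (bipower I J r s).
Proof. exact: mul_ideal. Qed.

Lemma bipowerC I J r s : bipower I J r s = bipower J I s r.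
Proof. exact: mul_comm. Qed.

Lemma bipower0l I J s : bipower I J 0 s = ideal_exp J s.
Proof. exact: (mul_setT (exp_ideal _ _)). Qed.

Lemma bipower_memr I J r s x y :
  J x -> bipower I J r s y -> bipower I J r s.+1 (x * y).
Proof.
move=> Jx; suff -> : bipower I J r s.+1 = ideal_mul J (bipower I J r s).
  exact: mul_memP.
by rewrite /bipower /= !mul_assoc (mul_comm J).
Qed.

Lemma bipower_meml I J r s x y :
  I x -> bipower I J r s y -> bipower I J r.+1 s (x * y).
Proof. by rewrite 2!(bipowerC I); apply: bipower_memr. Qed.

Lemma bipower_subr I J r s : bipower I J r s.+1 `<=` bipower I J r s.
Proof. by apply: mul_mono => //; apply: exp_subn. Qed.

Lemma bipower_subl I J r s : bipower I J r.+1 s `<=` bipower I J r s.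
Proof. by rewrite 2!(bipowerC I); apply: bipower_subr. Qed.

Lemma bipower_sub_exp I J r s : bipower I J r s `<=` ideal_exp J s.
Proof. exact: (mul_subr (exp_ideal _ _)). Qed.

Lemma joint_denC I J a b r s : joint_den I J a b r s = joint_den J I b a s r.
Proof. by rewrite /joint_den add_comm 2!(bipowerC I). Qed.

Lemma joint_den_ideal I J a b r s : ideal (joint_den I J a b r s).
Proof. by apply: add_ideal; apply: scale_ideal; apply: bipower_ideal. Qed.

Lemma joint_den_sub I J a b r s : I a -> J b ->
  joint_den I J a b r s `<=` bipower I J r.+1 s.+1.
Proof.
move=> Ia Jb; apply: add_min; first exact: bipower_ideal.
  by move=> _ [x hx <-]; apply: bipower_meml.
by move=> _ [x hx <-]; apply: bipower_memr.
Qed.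

Lemma M1C I J a b r s : M1 I J a b r s = M1 J I b a s r.
Proof. by rewrite /M1 bipowerC joint_denC. Qed.

(** Admitting k = 0 includes the unit ideal, so zeroth powers are covered as well. *)
Definition mcofinal m A : Prop := exists k, ideal_exp m k `<=` A.

Lemma mcofinal_sub m A B : mcofinal m A -> A `<=` B -> mcofinal m B.
Proof. by move=> [k h] AB; exists k; apply: subset_trans AB. Qed.

Lemma mcofinal_mul m A B :
  mcofinal m A -> mcofinal m B -> mcofinal m (ideal_mul A B).
Proof. by move=> [k hk] [l hl]; exists (k + l)%N; rewrite expD; apply: mul_mono. Qed.

Lemma mcofinal_exp m A n : mcofinal m A -> mcofinal m (ideal_exp A n).
Proof. by move=> h; elim: n => [|n IH]; [exists 0%N | apply: mcofinal_mul]. Qed.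

Lemma mcofinal_bipower m I J r s :
  mcofinal m I -> mcofinal m J -> mcofinal m (bipower I J r s).
Proof. by move=> hI hJ; apply: mcofinal_mul; apply: mcofinal_exp. Qed.

Lemma mcofinal_cofin m A : noetherian_local m -> ideal A ->
  mcofinal m A -> cofin A.
Proof.
by move=> [noeth mmax _] iA [k h]; apply: cofinS (cofin_exp k noeth mmax) iA h.
Qed.

Lemma primary_mcofinal m A : noetherian_local m -> is_primary_to m A ->
  [/\ ideal A, A `<=` m & mcofinal m A].
Proof.
move=> [noeth [[im _] _] _] [[[iA _] _] rad]; split=> //.
  by move=> x Ax; rewrite -rad; exists 1%N; rewrite expr1.
have [s es] := noeth m im; have [|n hn] := @span_exp_sub R s A iA.
  by move=> x xs; have : radical A x by rewrite rad es; apply: span_sub.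
by exists n; rewrite es.
Qed.

End Bipower.

Lemma colen_eq_sub (R : comNzRingType) (A B : set R) : cofin A -> ideal B ->
  A `<=` B -> colen A = colen B -> B `<=` A.
Proof.
move=> cA iB AB e; have [k [[_ hk] e']] := len_colen cA iB AB.
have iA := cofin_ideal cA.
have k0 : k = 0%N by lia.
apply: contrapT => nBA; suff /hk : strict_chain (submodules (Subquot B A)) 1.
  by rewrite k0.
exists (fun i => if i is 0%N then A else B); split=> [[|i] _|[|i]] //; split=> //=.
Qed.

Section Colengths.
Variable R : comNzRingType.
Implicit Types (I J : set R) (a b : R).

Definition bicolen I J r s : int := (colen (bipower I J r s))%:Z.

Definition bicolen_dif I J r s : int := bicolen I J r s.+1 - bicolen I J r s.

Definition pair_colen a b : int :=
  (colen (ideal_add (ideal_scale a setT) (ideal_scale b setT)))%:Z.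

(** Taken as a formula because it telescopes in r; it is identified with the length of M^1 for s
    past the Rees bound, where r may be arbitrary. *)
Definition M1_len I J a b r s : int :=
  pair_colen a b - (bicolen_dif I J r.+1 s - bicolen_dif I J r s).

Lemma bicolenC I J r s : bicolen I J r s = bicolen J I s r.
Proof. by rewrite /bicolen bipowerC. Qed.

Lemma pair_colenC a b : pair_colen a b = pair_colen b a.
Proof. by rewrite /pair_colen add_comm. Qed.

Lemma M1_len_sum I J a b r s : \sum_(0 <= i < r) M1_len I J a b i s =
  pair_colen a b * r%:Z - bicolen_dif I J r s + bicolen_dif I J 0 s.
Proof.
elim: r => [|r IH]; first by rewrite big_geq // mulr0; ring.
by rewrite big_nat_recr //= IH /M1_len -addn1 PoszD mulrDr; ring.
Qed.

Lemma iter_dif_eq0_leq u k l : (k <= l)%N ->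
  eventually (fun n => iter k dif u n = 0) -> eventually (fun n => iter l dif u n = 0).
Proof.
move=> /subnKC <-; elim: (l - k)%N => [|i IH]; first by rewrite addn0.
by move=> /IH[M h]; exists M => n Mn; rewrite addnS iterS /dif !h // leqW.
Qed.

Lemma dif_eq0_const u : eventually (fun n => dif u n = 0) ->
  exists c, eventually (fun n => u n = c).
Proof.
move=> [M h]; exists (u M), M => n /subnKC <-.
by rewrite (dif_const h) mul0r addr0.
Qed.

End Colengths.

(** * The statements on e_(0,1) and e_1(J); those on e_(1,0) and e_1(I) follow by exchanging (I, a)
    and (J, b) *)

Section Half.
Variables (R : comNzRingType) (m I J : set R) (a b : R).
Hypotheses (loc : noetherian_local m)
  (iJ : ideal J) (mI : mcofinal m I) (mJ : mcofinal m J)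
  (Im : I `<=` m) (Ia : I a) (Jb : J b).

Local Notation bR := (ideal_scale b (setT : set R)).
Local Notation ab := (ideal_add (ideal_scale a setT) bR).
Local Notation e := (pair_colen a b).
Local Notation f := (bicolen I J).
Local Notation g := (bicolen_dif I J).
Local Notation mlen := (M1_len I J a b).

Hypotheses (mab : mcofinal m ab) (hab : koszul_exact a b).

Let iab : ideal ab.
Proof. by apply: add_ideal; apply: scale_ideal idealT. Qed.

Let ibR : ideal bR. Proof. exact: scale_ideal idealT. Qed.

Let cbi r s : cofin (bipower I J r s).
Proof. exact/(mcofinal_cofin loc)/mcofinal_bipower/mJ/mI/bipower_ideal. Qed.

Let b_nzd y : b * y = 0 -> y = 0.
Proof. exact: (koszul_nzd loc (Im Ia) hab). Qed.

(** It contains (a,b) I^(r+1) J^(s+1). This gives finite colength for all r and s, also below the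
    range of the joint reduction equality. *)
Lemma joint_den_mcofinal r s : mcofinal m (joint_den I J a b r s).
Proof.
apply: mcofinal_sub (mcofinal_mul mab (mcofinal_bipower r.+1 s.+1 mI mJ)) _.
apply: mul_min; first exact: joint_den_ideal.
move=> _ z [_ [u _ <-] [_ [v _ <-] <-]] hz; rewrite mulrDl -!mulrA; apply: add_memP.
  exists (u * z) => //; apply: (idealMl _ (bipower_ideal _ _ _ _)).
  exact: bipower_subl.
exists (v * z) => //; apply: (idealMl _ (bipower_ideal _ _ _ _)).
exact: bipower_subr.
Qed.

(** By Koszul exactness and since X contains b, the colon (aX + (b)) : a is X, while adding (a) to
    aX + (b) gives (a,b), of colength e. *)
Lemma colen_scale_add (X : set R) : cofin X -> bR `<=` X ->
  cofin (ideal_add (ideal_scale a X) bR) ->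
  (colen (ideal_add (ideal_scale a X) bR))%:Z = (colen X)%:Z + e.
Proof.
move=> cX bX cE; have iX := cofin_ideal cX.
have := colen_colonT a cE.
have -> : colon (ideal_add (ideal_scale a X) bR) a = X.
  rewrite eqEsubset; split=> y.
    case=> _ [x Xx <-] [_ [t _ <-] ey].
    have [|z [e1 _]] := @hab (y - x) (- t); first by rewrite mulrBr -ey; ring.
    rewrite -[y](subrK x) e1; apply: idealD => //; apply: bX.
    by exists z; rewrite // mulrC.
  by move=> Xy; apply: addl_sub => //; exists y.
have -> : ideal_add (ideal_scale a setT) (ideal_add (ideal_scale a X) bR) = ab.
  rewrite eqEsubset; split; last by apply: add_mono => //; apply/addr_sub/scale_ideal.
  apply: add_min => //; first exact: addl_sub.
  by apply: add_mono => //; apply: scale_mono.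
by rewrite /pair_colen; lia.
Qed.

Lemma mcofinal_scale_add X : ideal X -> mcofinal m X ->
  mcofinal m (ideal_add (ideal_scale a X) bR).
Proof.
move=> iX mX; apply: mcofinal_sub (mcofinal_mul mab mX) _.
apply: mul_min; first by apply: add_ideal => //; apply: scale_ideal.
move=> _ z [_ [u _ <-] [_ [v _ <-] <-]] Xz; rewrite mulrDl -!mulrA; apply: add_memP.
  by exists (u * z) => //; apply: idealMl.
by exists (v * z).
Qed.

Local Notation G r s := (ideal_add bR (bipower I J r s)).

Let iG r s : ideal (G r s).
Proof. by apply: add_ideal => //; apply: bipower_ideal. Qed.

Let mG r s : mcofinal m (G r s).
Proof. exact: mcofinal_sub (mcofinal_bipower r s mI mJ) (addr_sub ibR). Qed.

Let cG r s : cofin (G r s).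
Proof. exact: (mcofinal_cofin loc (iG _ _) (mG _ _)). Qed.

Section Rees_b.
Variable N : nat.
Hypothesis reesb : forall r s, (N <= s)%N ->
  principal b `&` bipower I J r s.+1 = ideal_scale b (bipower I J r s).

Lemma colon_bipower r s : (N <= s)%N ->
  colon (bipower I J r s.+1) b = bipower I J r s.
Proof.
move=> Ns; rewrite eqEsubset; split=> y; last exact: bipower_memr.
rewrite /colon /= => hy.
have : (principal b `&` bipower I J r s.+1) (b * y).
  by split=> //; exists y; rewrite // mulrC.
rewrite reesb // => -[c hc ec].
suff -> : y = c by [].
by apply/eqP; rewrite -subr_eq0; apply/eqP/b_nzd; rewrite mulrBr ec subrr.
Qed.

Lemma colen_bipower_step r s : (N <= s)%N -> g r s = (colen (G r s.+1))%:Z.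
Proof.
move=> Ns; have := colen_colonT b (cbi r s.+1).
by rewrite colon_bipower // /bicolen_dif /bicolen; lia.
Qed.

(** A relation b y = a x + b w yields x = t b and y = w + a t. As x lies in I^r J^(s+1), the Rees
    condition puts t in I^r J^s, so a t lies in I^(r+1) J^s. *)
Lemma colon_joint_den r s : (N <= s)%N ->
  colon (joint_den I J a b r s) b = bipower I J r.+1 s.
Proof.
move=> Ns; rewrite eqEsubset; split=> y; last first.
  move=> hy; apply: addr_sub; first exact/scale_ideal/bipower_ideal.
  by exists y.
case=> _ [x hx <-] [_ [w hw <-] ey].
have [|t [ex ew]] := @hab x (w - y); first by rewrite mulrBr -ey; ring.
have ht : bipower I J r s t.
  by rewrite -colon_bipower // /colon /= mulrC -ex.
have -> : y = w + a * t by rewrite mulrC -[t * a]opprK -ew; ring.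
by apply: (idealD (bipower_ideal _ _ _ _)) => //; apply: bipower_meml.
Qed.

Lemma colen_joint_den r s : (N <= s)%N ->
  (colen (joint_den I J a b r s))%:Z = f r.+1 s + g r s + e.
Proof.
move=> Ns; have iD := joint_den_ideal I J a b r s.
have := colen_colonT b (mcofinal_cofin loc iD (joint_den_mcofinal r s)).
rewrite colon_joint_den // colen_bipower_step // .
(* Replacing I^r J^(s+1) by [G r s.+1] only adds multiples of ab, and it makes [colen_scale_add]
   applicable. *)
have -> : ideal_add bR (joint_den I J a b r s) = ideal_add (ideal_scale a (G r s.+1)) bR.
  rewrite eqEsubset; split.
    apply: add_min; first by apply: add_ideal => //; apply: scale_ideal.
      exact/addr_sub/scale_ideal.
    apply: add_mono; first by apply: scale_mono; apply: addr_sub.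
    by apply: scale_mono.
  apply: add_min; first exact: add_ideal.
    move=> _ [_ [_ [u _ <-] [x hx <-]] <-]; rewrite mulrDr mulrCA; apply: add_memP.
      by exists (a * u).
    apply: addl_sub; first exact/scale_ideal/bipower_ideal.
    by exists x.
  exact: addl_sub.
have cE : cofin (ideal_add (ideal_scale a (G r s.+1)) bR).
  apply: mcofinal_cofin loc _ (mcofinal_scale_add _ _) => //.
  by apply: add_ideal => //; apply: scale_ideal.
have := colen_scale_add (cG r s.+1) (addl_sub (bipower_ideal _ _ _ _)) cE.
by rewrite /bicolen; lia.
Qed.

Lemma mlenE r s : (N <= s)%N ->
  mlen r s = (colen (joint_den I J a b r s))%:Z - f r.+1 s.+1.
Proof. by move=> /(colen_joint_den r) ->; rewrite /M1_len /bicolen_dif; ring. Qed.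

Let cden r s : cofin (joint_den I J a b r s).
Proof. exact/(mcofinal_cofin loc)/joint_den_mcofinal/joint_den_ideal. Qed.

Lemma mod_length_M1 r s : (N <= s)%N ->
  mod_length (M1 I J a b r s) = (mlen r s)%:E%E.
Proof.
move=> Ns; rewrite mod_length_colen //; first by rewrite mlenE.
  exact: bipower_ideal.
exact: joint_den_sub.
Qed.

Lemma mlen_ge0 r s : (N <= s)%N -> 0 <= mlen r s.
Proof.
move=> Ns; rewrite mlenE // subr_ge0 lez_nat; apply: colen_le => //.
  exact: bipower_ideal.
exact: joint_den_sub.
Qed.

Lemma mlen_eq0 r s : (N <= s)%N -> mlen r s = 0 <-> sq_zero (M1 I J a b r s).
Proof.
move=> Ns; have sub := @joint_den_sub R I J a b r s Ia Jb.
rewrite mlenE // /bicolen; split=> [/subr0_eq[]|h].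
  exact: colen_eq_sub (cden r s) (bipower_ideal _ _ _ _) sub.
suff -> : bipower I J r.+1 s.+1 = joint_den I J a b r s by rewrite subrr.
by rewrite eqEsubset.
Qed.

Lemma g_row_mono r s : (N <= s)%N -> g r s <= g r.+1 s.
Proof.
move=> Ns; rewrite !colen_bipower_step // lez_nat; apply: colen_le => //.
by apply: add_mono => //; apply: bipower_subl.
Qed.

(** [g r] is the Hilbert function of the sum over s of I^r J^s / I^r J^(s+1), a graded module over
    the Rees algebra of J. *)
Lemma g_hilbert r : exists k, eventually (fun s => iter k dif (g r) s = 0).
Proof.
have [noeth _ _] := loc; have [xs exs] := noeth J iJ.
have := @hilbert_serre R J xs (noetherian_acc noeth) exs xs
  (bipower I J r) (fun s => bipower I J r s.+1).
case=> // [s|s|s|s x y Jx|s x y Jx|s x y -> //|M hM].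
- exact: bipower_ideal.
- exact: bipower_subr.
- exact: bipower_sub_exp.
- exact: bipower_memr.
- exact: bipower_memr.
by exists (size xs), M.
Qed.

Lemma g_row_const r : exists c, eventually (fun s => g r.+1 s - g r s = c).
Proof.
apply: dif_eq0_const.
have [k hk] := g_hilbert r; have [l hl] := g_hilbert r.+1.
apply: (@bounded_dif_eq0 (maxn k l) _ e).
  exists N => s Ns; have := mlen_ge0 r Ns; have := g_row_mono r Ns.
  by rewrite /M1_len; lia.
have [M hM] := eventually_and (iter_dif_eq0_leq (leq_maxl k l) hk)
                              (iter_dif_eq0_leq (leq_maxr k l) hl).
by exists M => s /hM[h1 h2]; rewrite iter_difB h1 h2 subrr.
Qed.

(** Since J contains m^c, it contains a^c, so a^c G(0,s+1) + (b) lies in G(0,s+2). Each factor a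
    costs e in colength, whence the bound c e. *)
Lemma g_col_bounded : exists c : int, forall s, (N <= s)%N -> `|dif (g 0) s| <= c.
Proof.
have [c hc] := mJ.
have Jac : J (a ^+ c) by apply/hc/exp_memX/Im.
exists (e *+ c) => s Ns.
(* This is a^n G(0,s+1) + (b), built so that [colen_scale_add] applies at each step. *)
pose X n := iter n (fun X => ideal_add (ideal_scale a X) bR) (G 0 s.+1).
have XP n : [/\ ideal (X n), mcofinal m (X n), bR `<=` X n &
    (colen (X n))%:Z = (colen (G 0 s.+1))%:Z + e *+ n].
  elim: n => [|n [iX mX bX eX]].
    by rewrite [X 0%N]/X /= addr0; split=> //; apply/addl_sub/bipower_ideal.
  have iX' : ideal (X n.+1) by apply: add_ideal => //; apply: scale_ideal.
  have mX' : mcofinal m (X n.+1) by apply: mcofinal_scale_add.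
  split=> //; first exact/addr_sub/scale_ideal.
  rewrite /= colen_scale_add //; first by rewrite -/(X n) eX mulrSr addrA.
    exact: (mcofinal_cofin loc iX mX).
  exact: (mcofinal_cofin loc iX' mX').
have XG n x : X n x -> exists u y, G 0 s.+1 y /\ x = b * u + a ^+ n * y.
  elim: n x => [|n IH] x; first by exists 0, x; rewrite mulr0 add0r mul1r.
  case=> _ [z /IH[u [y [Gy ->]]] <-] [_ [t _ <-] <-].
  by exists (a * u + t), y; split=> //; rewrite exprS; ring.
have [iX mX _ eX] := XP c.
have le1 : (colen (G 0 s.+2) <= colen (X c))%N.
  apply: colen_le => //; first exact: (mcofinal_cofin loc iX mX).
  move=> _ /XG[u [_ [[_ [t _ <-] [y hy <-]] ->]]].
  rewrite mulrDr addrA; apply: add_memP; last exact: bipower_memr.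
  by exists (u + a ^+ c * t) => //; ring.
have le2 : (colen (G 0 s.+1) <= colen (G 0 s.+2))%N.
  by apply: colen_le => //; apply: add_mono => //; apply: bipower_subr.
rewrite /dif !colen_bipower_step ?leqW //; lia.
Qed.

Lemma g_col_linear : exists alpha beta,
  eventually (fun s => g 0 s = alpha * s.+1%:Z - beta).
Proof.
have [c hc] := g_col_bounded; have [k hk] := g_hilbert 0.
have [|alpha [M hM]] := @dif_eq0_const (dif (g 0)).
  apply: (@bounded_dif_eq0 k _ c); first by exists N.
  have [K hK] := iter_dif_eq0_leq (leqnSn k) hk.
  by exists K => s /hK; rewrite iterSr.
(* The variable s + 1 matches the difference e_0 (n+1) - e_1 of the Hilbert polynomial, so that this
   constant becomes e_1(J). *)
exists alpha, (alpha * M.+1%:Z - g 0 M), M => s /subnKC <-.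
by rewrite (dif_const hM) -addSn PoszD; ring.
Qed.

Hypothesis red : forall r s, (N <= r)%N -> (N <= s)%N ->
  bipower I J r.+1 s.+1 = joint_den I J a b r s.

Lemma g_linear : exists alpha beta beta' M,
  [/\ (N <= M)%N, forall s, (M <= s)%N -> g 0 s = alpha * s.+1%:Z - beta &
      forall r s, (M <= r)%N -> (M <= s)%N ->
        g r s = alpha * s.+1%:Z + e * r%:Z - beta'].
Proof.
have [alpha [beta [M0 h0]]] := g_col_linear.
(* The bound on s grows with r, so this serves only to reach the row N. From there on, the vanishing
   of M^1 moves along the rows with a fixed bound on s. *)
have gr r : exists c, eventually (fun s => g r s = g 0 s + c).
  elim: r => [|r [c hc]]; first by exists 0, 0%N => s _; rewrite addr0.
  have [d hd] := g_row_const r; have [M hM] := eventually_and hc hd.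
  exists (c + d), M => s /hM[h1 h2].
  by rewrite addrA -h1 -h2 addrC subrK.
have [c [M1 h1]] := gr N.
pose M := maxn N (maxn M0 M1).
have [NM M0M M1M] : [/\ (N <= M)%N, (M0 <= M)%N & (M1 <= M)%N].
  by rewrite /M; split; lia.
exists alpha, beta, (beta + e * N%:Z - c), M; split=> // [s Ms|r s Mr Ms].
  by apply: h0; apply: leq_trans Ms.
have Ns : (N <= s)%N by apply: leq_trans Ms.
have -> : g r s = g N s + e * (r%:Z - N%:Z).
  have /subnKC <- : (N <= r)%N by apply: leq_trans Mr.
  elim: (r - N)%N => [|i IH]; first by rewrite addn0; ring.
  have : mlen (N + i) s = 0.
    by apply/mlen_eq0; rewrite // /sq_zero /M1 /= red // leq_addr.
  rewrite /M1_len IH => /eqP; rewrite subr_eq0 => /eqP he.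
  have -> : g (N + i.+1) s = e + (g N s + e * ((N + i)%N%:Z - N%:Z)).
    by rewrite [X in X + _]he addnS subrK.
  by rewrite !PoszD -addn1 PoszD; ring.
rewrite h1 ?h0; [ring | exact: leq_trans Ms | exact: leq_trans Ms].
Qed.

Lemma half_corollary : exists alpha beta beta',
  [/\ eventually (fun s => g 0 s = alpha * s.+1%:Z - beta),
      exists M, forall r s, (M <= r)%N -> (M <= s)%N ->
        g r s = alpha * s.+1%:Z + e * r%:Z - beta',
      exists M, forall r s, (M <= r)%N -> (M <= s)%N ->
        (beta' - beta)%:E%E = (\sum_(0 <= i < r) mod_length (M1 I J a b i s))%E,
      beta <= beta' /\ (beta' = beta <-> exists M, forall i s, (M <= s)%N ->
        sq_zero (M1 I J a b i s))
    & forall i, exists M, forall s, (M <= s)%N ->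
        mod_length (M1 I J a b i s) = mod_length (M1 I J a b i M)].
Proof.
have [alpha [beta [beta' [M [NM h0 hr]]]]] := g_linear.
have lenE i s : (M <= s)%N -> mod_length (M1 I J a b i s) = (mlen i s)%:E%E.
  by move=> Ms; apply: mod_length_M1; apply: leq_trans Ms.
have ge0 i s : (M <= s)%N -> 0 <= mlen i s.
  by move=> Ms; apply: mlen_ge0; apply: leq_trans Ms.
have sumE r s : (M <= r)%N -> (M <= s)%N ->
    \sum_(0 <= i < r) mlen i s = beta' - beta.
  by move=> Mr Ms; rewrite M1_len_sum hr // h0 //; ring.
exists alpha, beta, beta'; split.
- by exists M.
- by exists M.
- exists M => r s Mr Ms; rewrite -(sumE r s) //.
  elim: (r) => [|i IH]; first by rewrite !big_geq.
  by rewrite !big_nat_recr //= -IH lenE.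
- split.
    rewrite -subr_ge0 -(sumE M M) //; apply: sumr_ge0 => i _; exact: ge0.
  split=> [eb|[K hK]].
    exists M => i s Ms; apply/mlen_eq0; first exact: leq_trans Ms.
    (* The range reaches past M, where the sum is known, and past i, so that it contains the i-th
       term; nonnegative terms of sum zero all vanish. *)
    have := sumE (M + i.+1)%N s (leq_addr _ _) Ms.
    rewrite eb subrr => /eqP.
    rewrite psumr_eq0 => [/allP/(_ i)|j _]; last exact: ge0.
    by rewrite mem_index_iota leq0n ltn_addl //= => /(_ isT)/eqP.
  apply/eqP; rewrite -subr_eq0 -(sumE M (maxn M K)) ?leq_maxl //.
  rewrite big1_seq // => i _; apply/mlen_eq0; last exact/hK/leq_maxr.
  by apply: leq_trans NM (leq_maxl _ _).
move=> i; have [c [K hK]] := g_row_const i.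
exists (maxn M K) => s; rewrite geq_max => /andP[Ms Ks].
rewrite !lenE ?leq_maxl // /M1_len hK // hK ?leq_maxr //.
Qed.

End Rees_b.
End Half.

(** * Hilbert coefficients *)

Section HilbertCoefficients.
Variable R : comNzRingType.
Implicit Types (I J K : set R).

Lemma mod_length_colenT K : cofin K ->
  mod_length (Subquot setT K) = (colen K)%:Z%:E%E.
Proof. by move=> cK; rewrite mod_length_colen // colen_setT subr0. Qed.

Lemma posz_binS n k : 'C(n.+1, k.+1)%:Z = 'C(n, k.+1)%:Z + 'C(n, k)%:Z :> int.
Proof. by rewrite binS PoszD. Qed.

(** Since [hilbert_e1] reads a chosen triple, one triple is exhibited to exclude the default, its
    last entry being the constant of summation. Two consecutive differences then determine the
    linear coefficient of any triple. *)
Lemma hilbert_e1E K (alpha beta : int) : (forall n, cofin (ideal_exp K n)) ->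
  eventually (fun n => (colen (ideal_exp K n.+1))%:Z - (colen (ideal_exp K n))%:Z =
                       alpha * n.+1%:Z - beta) ->
  hilbert_e1 K = beta.
Proof.
move=> cK [M hM]; pose h n : int := (colen (ideal_exp K n))%:Z.
have ex : is_hilbert_coefs K
    (alpha, beta, h M - alpha * 'C(M.+1, 2)%:Z + beta * M%:Z).
  exists M => n /subnKC <-; rewrite mod_length_colenT // -/(h _).
  congr (_%:E)%E; elim: (n - M)%N => [|i IH]; first by rewrite addn0; ring.
  rewrite addnS; have -> : h (M + i).+1 = h (M + i)%N + (alpha * (M + i).+1%:Z - beta).
    by rewrite -hM ?leq_addr // /h addrC subrK.
  by rewrite IH (posz_binS (M + i).+1) bin1 -[(M + i).+1]addn1 !PoszD; ring.
rewrite /hilbert_e1 /hilbert_coefs; have := xgetI (0, 0, 0) ex.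
case: (xget _ _) => [[e0 e1] e2] [N hN] /=.
have step n : (maxn M N <= n)%N -> alpha * n.+1%:Z - beta = e0 * n.+1%:Z - e1.
  rewrite geq_max => /andP[Mn Nn]; rewrite -hM //.
  have := hN n Nn; rewrite mod_length_colenT // => -[->].
  have := hN n.+1 (leqW Nn); rewrite mod_length_colenT // => -[->].
  by rewrite (posz_binS n.+1) bin1 -[n.+1]addn1 !PoszD; ring.
have s1 := step _ (leqnn _); have s2 := step _ (leqnSn _).
move: s1 s2; set n := maxn M N; rewrite -[n.+2]addn1 PoszD => s1 s2.
have ea : alpha = e0.
  by move: s1 s2; rewrite !mulrDr !mulr1; lia.
by move: s1; rewrite ea; lia.
Qed.

(** The subtraction of naturals can truncate only for a lower index 0, where the binomial
    coefficient is 1 anyway. *)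
Lemma bihilbert_sum (E : 'M[int]_3) (r s : nat) :
  \sum_(i < 3) \sum_(j < 3 | (i + j <= 2)%N)
    (-1) ^+ (i + j) * E i j * ('C(r + i - 1, i))%:Z * ('C(s + j - 1, j))%:Z =
  E 0 0 - E 0 1 * s%:Z + E 0 2%:R * 'C(s.+1, 2)%:Z - E 1 0 * r%:Z +
  E 1 1 * r%:Z * s%:Z + E 2%:R 0 * 'C(r.+1, 2)%:Z.
Proof.
under eq_bigr do rewrite big_mkcond.
rewrite !big_ord_recl !big_ord0 /= /bump /=.
have -> : lift ord0 (lift ord0 ord0) = 2%:R :> 'I_3 by apply: val_inj.
have -> : lift ord0 ord0 = 1 :> 'I_3 by apply: val_inj.
have -> : ord0 = 0 :> 'I_3 by apply: val_inj.
rewrite !bin0 !addnK !addn2 !subn1 /= !bin1; ring.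
Qed.

Lemma bihilbert_eE I J (alpha beta alpha' beta' e : int) :
  (forall r s, cofin (bipower I J r s)) ->
  (exists M, forall r s, (M <= r)%N -> (M <= s)%N ->
    bicolen_dif I J r s = alpha * s.+1%:Z + e * r%:Z - beta) ->
  (exists M, forall r s, (M <= r)%N -> (M <= s)%N ->
    bicolen_dif J I s r = alpha' * r.+1%:Z + e * s%:Z - beta') ->
  bihilbert_e I J 0 1 = beta /\ bihilbert_e I J 1 0 = beta'.
Proof.
move=> cIJ [M1 h1] [M2 h2]; set M := maxn M1 M2.
have hs r s : (M <= r)%N -> (M <= s)%N ->
    bicolen I J r s.+1 = bicolen I J r s + (alpha * s.+1%:Z + e * r%:Z - beta).
  rewrite !geq_max => /andP[? _] /andP[? _]; rewrite -h1 //.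
  by rewrite /bicolen_dif addrC subrK.
have hr r s : (M <= r)%N -> (M <= s)%N ->
    bicolen I J r.+1 s = bicolen I J r s + (alpha' * r.+1%:Z + e * s%:Z - beta').
  rewrite !geq_max => /andP[_ ?] /andP[_ ?]; rewrite -h2 //.
  by rewrite /bicolen_dif ![bicolen J I _ _]bicolenC addrC subrK.
(* A common discrete primitive of both difference equations; it exists because the mixed coefficient
   [e] is the same in both. *)
pose P (r s : nat) : int := alpha * 'C(s.+1, 2)%:Z + alpha' * 'C(r.+1, 2)%:Z +
  e * r%:Z * s%:Z - beta * s%:Z - beta' * r%:Z.
have PS r s : P r s.+1 = P r s + (alpha * s.+1%:Z + e * r%:Z - beta).
  by rewrite /P (posz_binS s.+1) bin1 -[s.+1]addn1 !PoszD; ring.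
have PSr r s : P r.+1 s = P r s + (alpha' * r.+1%:Z + e * s%:Z - beta').
  by rewrite /P (posz_binS r.+1) bin1 -[r.+1]addn1 !PoszD; ring.
pose c := bicolen I J M M - P M M.
have hP r s : (M <= r)%N -> (M <= s)%N -> bicolen I J r s = P r s + c.
  move=> /subnKC <- /subnKC <-; elim: (r - M)%N => [|i IH].
    rewrite addn0; elim: (s - M)%N => [|j IH]; first by rewrite addn0 /c addrC subrK.
    by rewrite addnS hs ?leq_addr // IH PS addrAC.
  by rewrite addnS hr ?leq_addr // IH PSr addrAC.
pose E : 'M[int]_3 := \matrix_(i, j)
  (if (i == 0%N :> nat) && (j == 0%N :> nat) then c else
   if (i == 0%N :> nat) && (j == 1%N :> nat) then beta else
   if (i == 0%N :> nat) then alpha else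
   if (j == 0%N :> nat) && (i == 1%N :> nat) then beta' else
   if (j == 0%N :> nat) then alpha' else e).
have ex : is_bihilbert_coefs I J E.
  exists M => r s Mr Ms; rewrite mod_length_colenT // -/(bicolen I J r s).
  by rewrite bihilbert_sum hP // !mxE /= /P; congr (_%:E)%E; ring.
rewrite /bihilbert_e /bihilbert_coefs; have := xgetI 0 ex.
move: (xget _ _) => F [N]; set n := maxn M N => hN.
have eF r s : (n <= r)%N -> (n <= s)%N -> P r s + c =
  F 0 0 - F 0 1 * s%:Z + F 0 2%:R * 'C(s.+1, 2)%:Z - F 1 0 * r%:Z +
  F 1 1 * r%:Z * s%:Z + F 2%:R 0 * 'C(r.+1, 2)%:Z.
  move=> nr ns; rewrite -hP ?(leq_trans (leq_maxl M N)) //.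
  have Nr := leq_trans (leq_maxr M N) nr; have Ns := leq_trans (leq_maxr M N) ns.
  by have := hN r s Nr Ns; rewrite mod_length_colenT // bihilbert_sum => -[].
have eS r s : (n <= r)%N -> (n <= s)%N ->
    alpha * s.+1%:Z + e * r%:Z - beta =
    F 0 2%:R * s.+1%:Z + F 1 1 * r%:Z - F 0 1.
  move=> nr ns.
  have -> : alpha * s.+1%:Z + e * r%:Z - beta = (P r s.+1 + c) - (P r s + c).
    by rewrite PS; ring.
  rewrite !eF ?leqW // (posz_binS s.+1) bin1 -[s.+1]addn1 !PoszD; ring.
have eR r s : (n <= r)%N -> (n <= s)%N ->
    alpha' * r.+1%:Z + e * s%:Z - beta' =
    F 2%:R 0 * r.+1%:Z + F 1 1 * s%:Z - F 1 0.
  move=> nr ns.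
  have -> : alpha' * r.+1%:Z + e * s%:Z - beta' = (P r.+1 s + c) - (P r s + c).
    by rewrite PSr; ring.
  rewrite !eF ?leqW // (posz_binS r.+1) bin1 -[r.+1]addn1 !PoszD; ring.
(* An affine function of two variables is determined by its values at (k,k), (k+1,k) and (k,k+1). *)
have lin (x y z x' y' z' : int) (k : nat) :
    (forall i j, (k <= i)%N -> (k <= j)%N ->
      x * j.+1%:Z + y * i%:Z - z = x' * j.+1%:Z + y' * i%:Z - z') -> z' = z.
  move=> h; have h00 := h k k (leqnn _) (leqnn _).
  have h10 := h k.+1 k (leqnSn _) (leqnn _).
  have h01 := h k k.+1 (leqnn _) (leqnSn _).
  have ey : y = y' by lia.
  have ex' : x = x' by lia.
  by move: h00; rewrite ey ex'; lia.
split; first exact: lin eS.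
by apply: (lin alpha' e beta' _ _ _ n) => i j ni nj; apply: eR.
Qed.

End HilbertCoefficients.

Theorem corollary3p16 (R : comNzRingType) (m I J : set R) (a b : R)
  (hCM : cohen_macaulay_local m) (hdim : krull_dim R 2)
  (hinf : infinite_residue_field m)
  (hI : is_primary_to m I) (hJ : is_primary_to m J)
  (hab : rees_joint_reduction I J a b) :
  [/\ (* (a) *)
      exists N : nat, forall r s : nat, (N <= r)%N -> (N <= s)%N ->
        (bihilbert_e I J 0 1 - hilbert_e1 J)%:E%E =
          (\sum_(0 <= i < r) mod_length (M1 I J a b i s))%E /\
        (bihilbert_e I J 1 0 - hilbert_e1 I)%:E%E =
          (\sum_(0 <= i < s) mod_length (M1 I J a b r i))%E,
      (* (b) *)
      (hilbert_e1 J <= bihilbert_e I J 0 1 /\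
       (bihilbert_e I J 0 1 = hilbert_e1 J <->
        exists N : nat, forall i s : nat, (N <= s)%N ->
          sq_zero (M1 I J a b i s))) /\
      (hilbert_e1 I <= bihilbert_e I J 1 0 /\
       (bihilbert_e I J 1 0 = hilbert_e1 I <->
        exists N : nat, forall i r : nat, (N <= r)%N ->
          sq_zero (M1 I J a b r i)))
    & (* (c) *)
      (forall i : nat, exists N : nat, forall s : nat, (N <= s)%N ->
         mod_length (M1 I J a b i s) = mod_length (M1 I J a b i N)) /\
      (forall i : nat, exists N : nat, forall r : nat, (N <= r)%N ->
         mod_length (M1 I J a b r i) = mod_length (M1 I J a b N i))].
Proof.
have [loc _] := hCM.
have [iI Im mI] := primary_mcofinal loc hI.
have [iJ Jm mJ] := primary_mcofinal loc hJ.
have [[Ia Jb [N0 red]] [N1 reesa] [N2 reesb]] := hab.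
pose N := maxn N0 (maxn N1 N2).
have [NN0 NN1 NN2] : [/\ (N0 <= N)%N, (N1 <= N)%N & (N2 <= N)%N].
  by rewrite /N; split; lia.
(* One instance of the joint reduction equality suffices: it places I^(N0+1) J^(N0+1) inside
   (a,b). *)
have mab : mcofinal m (ideal_add (ideal_scale a setT) (ideal_scale b setT)).
  apply: mcofinal_sub (mcofinal_bipower N0.+1 N0.+1 mI mJ) _.
  by rewrite red //; apply: add_mono; apply: scale_mono.
have mba : mcofinal m (ideal_add (ideal_scale b setT) (ideal_scale a setT)).
  by rewrite add_comm.
have kab : koszul_exact a b by case: mab => k; apply: cm2_koszul.
have [||alpha [beta [beta' [h1 h2 h3 h4 h5]]]] :=
    @half_corollary R m I J a b loc iJ mI mJ Im Ia Jb mab kab N.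
- by move=> r s Ns; apply: reesb; apply: leq_trans Ns.
- by move=> r s Nr Ns; apply: red; [apply: leq_trans Nr | apply: leq_trans Ns].
have [||alpha' [gamma [gamma' [k1 k2 k3 k4 k5]]]] :=
    @half_corollary R m J I b a loc iI mJ mI Jm Jb Ia mba (koszul_exactC kab) N.
- move=> s r Nr; rewrite 2!(bipowerC J); apply: reesa; exact: leq_trans Nr.
- move=> s r Ns Nr; rewrite bipowerC joint_denC; apply: red.
    exact: leq_trans Nr.
  exact: leq_trans Ns.
have cof A : ideal A -> mcofinal m A -> cofin A by apply: mcofinal_cofin.
have [e01 e10] : bihilbert_e I J 0 1 = beta' /\ bihilbert_e I J 1 0 = gamma'.
  apply: (@bihilbert_eE R I J alpha beta' alpha' gamma' (pair_colen a b)) => //.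
    by move=> r s; apply: cof; [apply: bipower_ideal | apply: mcofinal_bipower].
  by have [M hM] := k2; exists M => r s Mr Ms; rewrite hM // pair_colenC.
have e1J : hilbert_e1 J = beta.
  apply: (@hilbert_e1E R J alpha).
    by move=> n; apply: cof; [apply: exp_ideal | apply: mcofinal_exp].
  by have [M hM] := h1; exists M => n Mn; rewrite -hM // -2!(bipower0l I).
have e1I : hilbert_e1 I = gamma.
  apply: (@hilbert_e1E R I alpha').
    by move=> n; apply: cof; [apply: exp_ideal | apply: mcofinal_exp].
  by have [M hM] := k1; exists M => n Mn; rewrite -hM // -2!(bipower0l J).
rewrite e01 e10 e1J e1I; split.
- have [M hM] := h3; have [K hK] := k3; exists (maxn M K) => r s.
  rewrite !geq_max => /andP[Mr Kr] /andP[Ms Ks]; split; first exact: hM.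
  by rewrite (hK s r) //; apply: eq_bigr => i _; rewrite M1C.
- split=> //; split; first by case: k4.
  case: k4 => _ ->; split=> -[M hM]; exists M => i r Mr.
    by rewrite M1C; apply: hM.
  by rewrite M1C; apply: hM.
split=> // i; have [M hM] := k5 i; exists M => r Mr.
by rewrite 2!(M1C I); apply: hM.
Qed.
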